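(* Every language recognized by $\mathbf{L}^{*}\Diamond$ (the Lambek calculus with brackets allowing empty antecedents) is context-free. That is, for every $\mathbf{L}^{*}\Diamond$ grammar $G$, the language $L(G)$ generated by $G$ is context-free.
   Context: Types. Let $\mathrm{Pr}=\{p_1,p_2,p_3,\dots\}$ be an infinite set of primitive types. For a set $\mathcal{B}$, $\mathrm{Tp}(\mathcal{B})$ is the smallest superset of $\mathcal{B}$ such that $A,B\in \mathrm{Tp}(\mathcal{B})$ implies $A\backslash B,\ B/A,\ A\bullet B,\ \Diamond A,\ \Box^{\downarrow}A\in\mathrm{Tp}(\mathcal{B})$. A type is an element of $\mathrm{Tp}(\mathrm{Pr})$. Type trees and type hedges (simultaneous induction): every type is a type tree; if $\Gamma$ is a type hedge then $\langle\Gamma\rangle$ is a type tree; if $T_1,\dots,T_n$ ($n\ge 0$) are type trees then the finite sequence $T_1\dots T_n$ is a type hedge (empty if $n=0$). Juxtaposition $\Pi\;\Gamma$ is concatenation of hedges. The yield of a hedge is the string of types obtained by removing all angle brackets. A context $\Gamma[\blacksquare]$ is like a type hedge except that exactly one leaf is labeled by the special symbol $\blacksquare$ (all other leaf labels being types); $\Gamma[\Delta]$ is the hedge obtained by replacing that leaf by the hedge $\Delta$ (spliced in among the siblings of the leaf). A sequent is $\Gamma\rightarrow A$ with $\Gamma$ a type hedge (the antecedent, possibly empty) and $A$ a type. The calculus $\mathbf{L}^{*}\Diamond$. Initial sequents: $p_i\rightarrow p_i$ for primitive types $p_i$. Rules (premises $\Rightarrow$ conclusion; all hedges may be empty, and $\langle\rangle$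 may occur): - $(\backslash\rightarrow)$: $\Gamma\rightarrow A$ and $\Delta[B]\rightarrow C$ $\Rightarrow$ $\Delta[\Gamma\; A\backslash B]\rightarrow C$. - $(\rightarrow\backslash)$: $A\;\Pi\rightarrow B$ $\Rightarrow$ $\Pi\rightarrow A\backslash B$. - $(/\rightarrow)$: $\Gamma\rightarrow A$ and $\Delta[B]\rightarrow C$ $\Rightarrow$ $\Delta[B/A\;\Gamma]\rightarrow C$. - $(\rightarrow/)$: $\Pi\;A\rightarrow B$ $\Rightarrow$ $\Pi\rightarrow B/A$. - $(\bullet\rightarrow)$: $\Gamma[A\;B]\rightarrow C$ $\Rightarrow$ $\Gamma[A\bullet B]\rightarrow C$. - $(\rightarrow\bullet)$: $\Gamma\rightarrow A$ and $\Delta\rightarrow B$ $\Rightarrow$ $\Gamma\;\Delta\rightarrow A\bullet B$. - $(\Diamond\rightarrow)$: $\Gamma[\langle A\rangle]\rightarrow B$ $\Rightarrow$ $\Gamma[\Diamond A]\rightarrow B$. - $(\rightarrow\Diamond)$: $\Gamma\rightarrow A$ $\Rightarrow$ $\langle\Gamma\rangle\rightarrow\Diamond A$. - $(\Box^{\downarrow}\rightarrow)$: $\Gamma[A]\rightarrow B$ $\Rightarrow$ $\Gamma[\langle\Box^{\downarrow}A\rangle]\rightarrow B$. - $(\rightarrow\Box^{\downarrow})$: $\langle\Gamma\rangle\rightarrow A$ $\Rightarrow$ $\Gamma\rightarrow\Box^{\downarrow}A$. - Cut: $\Gamma\rightarrow A$ and $\Delta[A]\rightarrow B$ $\Rightarrow$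 $\Delta[\Gamma]\rightarrow B$. A sequent is provable if it can be derived from initial sequents by these rules. Grammars. An $\mathbf{L}^{*}\Diamond$ grammar is a triple $G=(\Sigma,I,D)$ where $\Sigma$ is a finite alphabet, $I$ is a finite subset of $\Sigma\times\mathrm{Tp}(\mathrm{Pr})$, and $D$ is a type. A string $w=a_1\dots a_n$ ($n\ge 0$) is generated by $G$ if there is a sequent $\Gamma\rightarrow D$ provable in $\mathbf{L}^{*}\Diamond$ such that the yield of $\Gamma$ is $A_1\dots A_n$ and $(a_i,A_i)\in I$ for each $i=1,\dots,n$. $L(G)$ is the set of strings $w\in\Sigma^*$ generated by $G$. A language is recognized by $\mathbf{L}^{*}\Diamond$ if it is $L(G)$ for some $\mathbf{L}^{*}\Diamond$ grammar $G$. *)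

(* Defs.v *)
From HB Require Import structures.
From mathcomp Require Import all_boot.
From Stdlib Require Import Relation_Operators.

Set Implicit Arguments.
Unset Strict Implicit.
Unset Printing Implicit Defensive.

(* [Prim i] ranges over the countably infinite set of primitive types;
   [LDiv A B] is A\B, whereas [RDiv B A] is B/A. *)
Inductive tp : Type :=
  | Prim of nat
  | LDiv of tp & tp
  | RDiv of tp & tp
  | Prod of tp & tp
  | Dia of tp
  | Box of tp.

Lemma tp_comparable : comparable tp.
Proof. by rewrite /comparable /decidable; decide equality; exact: eq_comparable. Qed.

HB.instance Definition _ := hasDecEq.Build tp (compareP tp_comparable).

Inductive tree : Type :=
  | Leaf of tp
  | Bracket of seq tree.

Notation hedge := (seq tree).

Fixpoint tree_yield (t : tree) : seq tp :=
  match t with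
  | Leaf A => [:: A]
  | Bracket G => flatten (map tree_yield G)
  end.

Definition yield (G : hedge) : seq tp := flatten (map tree_yield G).

(* The path to the unique hole: [Hole l r] is the context l # r with the hole #
   at the top level, and [Inside l C r] is l <C> r, with the hole inside C. *)
Inductive context : Type :=
  | Hole of hedge & hedge
  | Inside of hedge & context & hedge.

Fixpoint fill (C : context) (D : hedge) : hedge :=
  match C with
  | Hole l r => l ++ D ++ r
  | Inside l C' r => l ++ Bracket (fill C' D) :: r
  end.

Inductive provable : hedge -> tp -> Prop :=
  | ax i : provable [:: Leaf (Prim i)] (Prim i)
  | ldivL G A D B C :
      provable G A -> provable (fill D [:: Leaf B]) C ->
      provable (fill D (G ++ [:: Leaf (LDiv A B)])) C
  | ldivR P A B :
      provable (Leaf A :: P) B -> provable P (LDiv A B)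
  | rdivL G A D B C :
      provable G A -> provable (fill D [:: Leaf B]) C ->
      provable (fill D (Leaf (RDiv B A) :: G)) C
  | rdivR P A B :
      provable (P ++ [:: Leaf A]) B -> provable P (RDiv B A)
  | prodL G A B C :
      provable (fill G [:: Leaf A; Leaf B]) C ->
      provable (fill G [:: Leaf (Prod A B)]) C
  | prodR G D A B :
      provable G A -> provable D B -> provable (G ++ D) (Prod A B)
  | diaL G A B :
      provable (fill G [:: Bracket [:: Leaf A]]) B ->
      provable (fill G [:: Leaf (Dia A)]) B
  | diaR G A :
      provable G A -> provable [:: Bracket G] (Dia A)
  | boxL G A B :
      provable (fill G [:: Leaf A]) B ->
      provable (fill G [:: Bracket [:: Leaf (Box A)]]) B
  | boxR G A :
      provable [:: Bracket G] A -> provable G (Box A)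
  | cut G D A B :
      provable G A -> provable (fill D [:: Leaf A]) B ->
      provable (fill D G) B.

Definition language (Sigma : finType) : Type := seq Sigma -> Prop.

Record lambek_grammar (Sigma : finType) : Type := LambekGrammar {
  lexicon : seq (Sigma * tp);
  goal : tp
}.

(* [all2] is false on sequences of different lengths. *)
Definition lambek_language (Sigma : finType) (G : lambek_grammar Sigma) :
    language Sigma :=
  fun w => exists H : hedge,
    provable H (goal G) /\ all2 (fun a A => (a, A) \in lexicon G) w (yield H).

Definition recognized (Sigma : finType) (L : language Sigma) : Prop :=
  exists G : lambek_grammar Sigma, forall w, L w <-> lambek_language G w.

Record cfg (Sigma : finType) : Type := Cfg {
  nonterminal : finType;
  productions : seq (nonterminal * seq (nonterminal + Sigma));
  start : nonterminal
}.

Inductive cfg_step (Sigma : finType) (G : cfg Sigma) :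
    seq (nonterminal G + Sigma) -> seq (nonterminal G + Sigma) -> Prop :=
  | CfgStep u v X r : (X, r) \in productions G ->
      cfg_step (u ++ inl X :: v) (u ++ r ++ v).

Definition cfg_language (Sigma : finType) (G : cfg Sigma) : language Sigma :=
  fun w => clos_refl_trans _ (@cfg_step Sigma G)
             [:: inl (start G)] (map inr w).

Definition context_free (Sigma : finType) (L : language Sigma) : Prop :=
  exists G : cfg Sigma, forall w, L w <-> cfg_language G w.

(* Main.v *)
Require Import Defs.
From HB Require Import structures.
From mathcomp Require Import all_boot zify.
From Stdlib Require Import Classical Relation_Operators Operators_Properties.
From Stdlib Require List.

Set Implicit Arguments.
Unset Strict Implicit.
Unset Printing Implicit Defensive.

(** The argument is the one Pentus gave for the Lambek calculus, carried over
    to brackets and empty antecedents.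

    The nonterminals of the grammar are the types whose length is at most some
    [m] and whose names are below some bound, both read off the lexicon and the
    goal: there are finitely many ([short_types]).  A right-hand side has at most two
    symbols, and [X -> r] is a production as soon as some derivable sequent has
    succedent [X] and an antecedent whose leaves are denoted by [r]; brackets
    are free, since they leave no trace in the string.  Such a grammar generates
    only strings of the language because derivability is closed under cut
    ([derivation_sound]).  It generates all of them ([derivation_complete]) if
    every derivable sequent with three leaves or more can be shortened: its
    antecedent has a piece [D] of at least two tokens, and some type [B] of
    length at most [m] fits between [D] and its surroundings, meaning that
    [D -> B] is derivable and that [B] can stand for [D] in the sequent.

    Such a [B] is an interpolant ([interpolation]): each letter of [B] occurs
    both in [D] and outside of [D].  To bound the length of [B], the sequent is
    first replaced by a thin one, of which it is a renaming and in which each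
    primitive type and each modality has exactly two occurrences, a bracket
    counting as one of a modality ([thin_instance]); modalities and brackets
    carry an index for this purpose.
    In a thin sequent an interpolant is no longer than the number of letters of
    [D] whose mate lies outside of [D] ([interpolant_thin]), the crossings of
    [D].  Types read as words over a free group in which both sides of a
    derivable sequent are equal ([cfree_red]), with a pair of letters for each
    modality and each bracket pair; so mates are joined by links that do not
    cross ([red_noncrossing]).  Two cases give a piece with at most [m]
    crossings ([short_piece]).

    - If the antecedent has a bracket, the mates of its two letters are in the
      same type [C], and noncrossing forces every link that leaves the bracket,
      or its content, to have an end in [C] ([bracket_short]).

    - If the antecedent is a string of types, consider a prefix with the most
      crossings.  In the tree spanned by the prefixes, the neighbours of a point
      farthest from the root are no farther from each other than one of them is
      from that point ([four_point]), so that two adjacent types form a short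
      piece; if the
      farthest point is the end of the string, all types but the last do
      ([flat_short]).

    The empty antecedent is where a multiplicative unit is needed: nothing but
    [Dia 1] interpolates an empty bracket.  Adding that one constant to the
    types, and not the unit itself, keeps the types of bounded length finite in
    number.  Both the bracketed hedges and this constant are handled in a
    cut-free calculus on strings of tokens, in which cut is admissible
    ([cut_admissible]). *)

(** * A cut-free calculus on strings of tokens *)

(** The index of a modality is also that of the bracket pairs it speaks of; in a
    thin sequent it tells them apart.  [IDia1 k] stands for [IDia k] applied to
    the multiplicative unit. *)
Inductive itp : Type :=
  | IPrim of nat
  | ILDiv of itp & itp
  | IRDiv of itp & itp
  | IProd of itp & itp
  | IDia of nat & itp
  | IBox of nat & itp
  | IDia1 of nat.

Lemma itp_comparable : comparable itp.
Proof. by rewrite /comparable /decidable; decide equality; exact: eq_comparable. Qed.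

HB.instance Definition _ := hasDecEq.Build itp (compareP itp_comparable).

(** A hedge is written as a string with explicit brackets, so that a context is
    just a pair of strings and no recursion on trees is needed. *)
Inductive token : Type := Lf of itp | Op of nat | Cl of nat.

Lemma cat_eq_cat (T : Type) (a b c d : seq T) :
  a ++ b = c ++ d ->
  (exists e, a = c ++ e /\ d = e ++ b) \/ (exists e, c = a ++ e /\ b = e ++ d).
Proof.
elim: a c => [|x a IH] [|y c] /=.
- by move=> ->; left; exists [::].
- by move=> ->; right; exists (y :: c).
- by move=> <-; left; exists (x :: a).
case=> -> /IH [[e [-> ->]]|[e [-> ->]]]; by [left; exists e | right; exists e].
Qed.

(** The stack holds the indices of the open brackets. *)
Fixpoint run (st : seq nat) (s : seq token) : option (seq nat) :=
  match s with
  | [::] => Some st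
  | Lf _ :: s' => run st s'
  | Op k :: s' => run (k :: st) s'
  | Cl k :: s' =>
      if st is j :: st' then if j == k then run st' s' else None else None
  end.

Definition bal (s : seq token) : bool := run [::] s == Some [::].

Lemma run_cat st s t : run st (s ++ t) = obind (run^~ t) (run st s).
Proof.
elim: s st => [|[A|k|k] s IH] st //=.
by case: st => [|j st] //=; case: (j == k).
Qed.

(** A run that succeeds never looks below its initial stack. *)
Lemma run_frame st st' s st0 :
  run st s = Some st' -> run (st ++ st0) s = Some (st' ++ st0).
Proof.
elim: s st => [|[A|k|k] s IH] st /=; [by case=> -> | exact: IH | exact: IH |].
by case: st => [|j st] //=; case: (j == k) => //; exact: IH.
Qed.

Lemma run_bal st s : bal s -> run st s = Some st.
Proof. by move/eqP/run_frame => /(_ st). Qed.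

Lemma run_bal_cat st s t : bal s -> run st (s ++ t) = run st t.
Proof. by move=> bs; rewrite run_cat run_bal. Qed.

Lemma bal_cat s t : bal s -> bal t -> bal (s ++ t).
Proof. by move=> bs bt; rewrite /bal run_bal_cat. Qed.

Lemma bal_splice l s t r : bal s -> bal t -> bal (l ++ s ++ r) = bal (l ++ t ++ r).
Proof.
move=> bs bt; rewrite /bal !run_cat; case: (run [::] l) => //= st.
by rewrite !run_bal_cat.
Qed.

Lemma bal_remove l s r : bal s -> bal (l ++ s ++ r) = bal (l ++ r).
Proof. by move=> bs; rewrite (@bal_splice l s [::] r). Qed.

Lemma bal_bracket k s : bal s -> bal (Op k :: s ++ [:: Cl k]).
Proof. by move=> bs; rewrite /bal /= run_bal_cat //= eqxx. Qed.

Lemma run_prefix st s t st' :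
  run st (s ++ t) = Some st' -> exists2 st1, run st s = Some st1 & run st1 t = Some st'.
Proof. by rewrite run_cat; case: (run st s) => //= st1 h; exists st1. Qed.

(** In [a], [b] and [c], an open bracket of [a] cannot be closed in [b], since [b]
    is a prefix of a balanced string. *)
Lemma bal_overlap a b c :
  bal (a ++ b) -> bal (b ++ c) -> [/\ bal a, bal b & bal c].
Proof.
move=> /eqP /run_prefix [st ha hb] /eqP /run_prefix [st2 hb' hc].
move: (run_frame st hb'); rewrite /= hb => -[].
case: st2 hb' hc => [|//] hb' hc /= st0; rewrite -st0 in ha.
by rewrite /bal ha hb' hc.
Qed.

(** The next two lemmas say that balanced strings never overlap properly: a
    prefix or a suffix of one contains no unmatched bracket of the wrong kind. *)
Lemma bal_no_cross_open k a b : bal (a ++ b) -> ~~ bal (Op k :: a).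
Proof.
move=> /eqP /run_prefix [st ha _]; rewrite /bal /=.
by move: (run_frame [:: k] ha) => /= ->; case: st {ha}.
Qed.

Lemma bal_no_cross_close k a b c : bal (a ++ b) -> ~~ bal (b ++ Cl k :: c).
Proof.
move=> /eqP /run_prefix [st ha hb]; apply/negP => /eqP /run_prefix [st2 hb' hc].
move: (run_frame st hb'); rewrite /= hb => -[].
by case: st2 hb' hc.
Qed.

(** A closing bracket after a balanced string is the first unmatched one. *)
Lemma bal_close_inj a b i j c d :
  bal a -> bal b -> a ++ Cl i :: c = b ++ Cl j :: d -> a = b /\ c = d.
Proof.
move=> ba bb e.
have no_ext k u v : bal u -> ~~ bal (u ++ Cl k :: v).
  by move=> bu; apply: (@bal_no_cross_close k [::]).
case: (cat_eq_cat e) => [[[|x f] []]|[[|x f] []]].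
- by rewrite cats0 => -> [].
- by move=> ea [ex _]; move: ba; rewrite ea -ex (negPf (no_ext _ _ _ bb)).
- by rewrite cats0 => -> [].
- by move=> eb [ex _]; move: bb; rewrite eb -ex (negPf (no_ext _ _ _ ba)).
Qed.

(** The contexts [l], [r] of the left rules may be unbalanced strings.  The side
    condition of [cf_boxR] makes up for this: without it the brackets that the
    rule removes need not match each other, as in [Op k :: Cl k :: Op k :: Cl k]. *)
Inductive cfree : seq token -> itp -> Prop :=
  | cf_ax p : cfree [:: Lf (IPrim p)] (IPrim p)
  | cf_ldivL l G r A B C :
      cfree G A -> cfree (l ++ Lf B :: r) C ->
      cfree (l ++ G ++ Lf (ILDiv A B) :: r) C
  | cf_ldivR G A B : cfree (Lf A :: G) B -> cfree G (ILDiv A B)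
  | cf_rdivL l G r A B C :
      cfree G A -> cfree (l ++ Lf B :: r) C ->
      cfree (l ++ Lf (IRDiv B A) :: G ++ r) C
  | cf_rdivR G A B : cfree (G ++ [:: Lf A]) B -> cfree G (IRDiv B A)
  | cf_prodL l r A B C :
      cfree (l ++ Lf A :: Lf B :: r) C -> cfree (l ++ Lf (IProd A B) :: r) C
  | cf_prodR G D A B : cfree G A -> cfree D B -> cfree (G ++ D) (IProd A B)
  | cf_diaL l r k A C :
      cfree (l ++ Op k :: Lf A :: Cl k :: r) C -> cfree (l ++ Lf (IDia k A) :: r) C
  | cf_diaR k G A : cfree G A -> cfree (Op k :: G ++ [:: Cl k]) (IDia k A)
  | cf_dia1L l r k C :
      cfree (l ++ Op k :: Cl k :: r) C -> cfree (l ++ Lf (IDia1 k) :: r) C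
  | cf_dia1R k : cfree [:: Op k; Cl k] (IDia1 k)
  | cf_boxL l r k A C :
      cfree (l ++ Lf A :: r) C -> cfree (l ++ Op k :: Lf (IBox k A) :: Cl k :: r) C
  | cf_boxR k G A :
      bal G -> cfree (Op k :: G ++ [:: Cl k]) A -> cfree G (IBox k A).

Lemma bal_Lf l A r : bal (l ++ Lf A :: r) = bal (l ++ r).
Proof. exact: (@bal_remove l [:: Lf A] r). Qed.

Lemma cfree_bal s A : cfree s A -> bal s.
Proof.
elim=> {s A} //=.
- by move=> l G r A B C _ bG _; rewrite bal_Lf bal_remove // bal_Lf.
- by move=> l G r A B C _ bG _; rewrite !bal_Lf bal_remove.
- by move=> G A B _; rewrite bal_Lf cats0.
- by move=> l r A B C _; rewrite !bal_Lf.
- by move=> G D A B _ bG _ bD; exact: bal_cat.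
- move=> l r k A C _; rewrite bal_Lf (@bal_remove l [:: Op k; Lf A; Cl k]) //.
  by rewrite /bal /= eqxx.
- by move=> k G A _; exact: bal_bracket.
- move=> l r k C _; rewrite bal_Lf (@bal_remove l [:: Op k; Cl k]) //.
  by rewrite /bal /= eqxx.
- by move=> k; rewrite /bal /= eqxx.
- move=> l r k A C _; rewrite bal_Lf (@bal_remove l [:: Op k; Lf _; Cl k]) //.
  by rewrite /bal /= eqxx.
Qed.

(** * Admissibility of cut *)

(** Cut is admissible because a model built from cut-free derivability is sound
    for the calculus, and cut holds in the model by composition.  A proposition
    is a set of strings closed under [cl]: it contains each string that can
    replace its members in all derivable sequents. *)
Definition cl (X : seq token -> Prop) (G : seq token) : Prop :=
  forall l r C, (forall D, X D -> cfree (l ++ D ++ r) C) -> cfree (l ++ G ++ r) C.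

Fixpoint den (A : itp) : seq token -> Prop :=
  match A with
  | IPrim p => fun G => cfree G (IPrim p)
  | ILDiv A B => fun G => forall D, den A D -> den B (D ++ G)
  | IRDiv B A => fun G => forall D, den A D -> den B (G ++ D)
  | IProd A B => cl (fun G => exists D E, [/\ den A D, den B E & G = D ++ E])
  | IDia k A => cl (fun G => exists2 D, den A D & G = Op k :: D ++ [:: Cl k])
  | IBox k A => fun G => bal G /\ den A (Op k :: G ++ [:: Cl k])
  | IDia1 k => cl (fun G => G = [:: Op k; Cl k])
  end.

Definition closed (X : seq token -> Prop) : Prop := forall G, cl X G -> X G.

Lemma cl_closed X : closed (cl X).
Proof. by move=> G h l r C hX; apply: h => D; apply. Qed.

(** Closed sets are stable under taking a string out of its context, which is
    what validates the left rules. *)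
Lemma closed_ctx X Y l r G :
  closed X -> cl Y G -> (forall D, Y D -> X (l ++ D ++ r)) -> X (l ++ G ++ r).
Proof.
move=> cX cY h; apply: cX => l' r' C hC.
have := cY (l' ++ l) (r ++ r') C; rewrite -!catA; apply=> D /h /hC.
by rewrite -!catA.
Qed.

(** The first two parts squeeze [den A] between the string [A] and the set of
    strings that derive [A]; this turns truth in the model into derivability.
    The box needs the second part to see that the members of a closure are
    balanced. *)
Lemma den_adequate A :
  [/\ den A [:: Lf A], forall G, den A G -> cfree G A & closed (den A)].
Proof.
elim: A => [p|A [A1 A2 A3] B [B1 B2 B3]|B [B1 B2 B3] A [A1 A2 A3]
           |A [A1 A2 A3] B [B1 B2 B3]|k A [A1 A2 A3]|k A [A1 A2 A3]|k] /=.
- split=> // [|G h]; first exact: cf_ax.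
  by have := h [::] [::] (IPrim p); rewrite /= cats0; apply=> D; rewrite cats0.
- split.
  + move=> D dD; apply: B3 => l r C h; rewrite -catA.
    by apply: cf_ldivL; [exact: A2 | exact: (h _ B1)].
  + by move=> G h; apply: cf_ldivR; apply: B2; exact: (h _ A1).
  + move=> G cG D dD; have := @closed_ctx _ _ D [::] G B3 cG.
    by rewrite cats0; apply=> E; rewrite cats0; apply.
- split.
  + move=> D dD; apply: B3 => l r C h; rewrite /=.
    by apply: cf_rdivL; [exact: A2 | exact: (h _ B1)].
  + by move=> G h; apply: cf_rdivR; apply: B2; exact: (h _ A1).
  + by move=> G cG D dD; apply: (@closed_ctx _ _ [::] D G B3 cG) => E; apply.
- split; last exact: cl_closed.
  + move=> l r C h; apply: cf_prodL; apply: (h [:: Lf A; Lf B]).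
    by exists [:: Lf A], [:: Lf B].
  + move=> G /(_ [::] [::] (IProd A B)); rewrite /= cats0; apply=> D.
    by case=> E [F [dE dF ->]]; rewrite cats0; apply: cf_prodR; auto.
- split; last exact: cl_closed.
  + move=> l r C h; apply: cf_diaL; apply: (h [:: Op k; Lf A; Cl k]).
    by exists [:: Lf A].
  + move=> G /(_ [::] [::] (IDia k A)); rewrite /= cats0; apply=> D.
    by case=> E dE ->; rewrite cats0; apply: cf_diaR; auto.
- have box_cfree G : bal G /\ den A (Op k :: G ++ [:: Cl k]) -> cfree G (IBox k A).
    by case=> bG dG; apply: cf_boxR => //; exact: A2.
  split=> //.
  + split=> //; apply: A3 => l r C h; apply: cf_boxL; exact: (h _ A1).
  + move=> G cG; split.
      apply: (@cfree_bal _ (IBox k A)).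
      have := cG [::] [::] (IBox k A); rewrite /= cats0; apply=> D.
      by rewrite cats0; exact: box_cfree.
    by apply: (@closed_ctx _ _ [:: Op k] [:: Cl k] G A3 cG) => D [].
- split; last exact: cl_closed.
  + by move=> l r C h; apply: cf_dia1L; exact: (h [:: Op k; Cl k]).
  + move=> G /(_ [::] [::] (IDia1 k)); rewrite /= cats0; apply=> D ->.
    exact: cf_dia1R.
Qed.

(** The reading of antecedents in the model, where brackets stand for themselves. *)
Fixpoint dens (s : seq token) : seq token -> Prop :=
  match s with
  | [::] => fun G => G = [::]
  | Lf A :: s' => fun G => exists D E, [/\ den A D, dens s' E & G = D ++ E]
  | t :: s' => fun G => exists2 E, dens s' E & G = t :: E
  end.

Lemma dens_refl s : dens s s.
Proof.
elim: s => [|[A|k|k] s IH] //=; try by exists s.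
by exists [:: Lf A], s; split=> //; case: (den_adequate A).
Qed.

Lemma dens_cat s t G :
  dens (s ++ t) G <-> exists D E, [/\ dens s D, dens t E & G = D ++ E].
Proof.
elim: s G => [|x s IH] G /=.
  by split=> [h|[D [E [-> h ->]]] //]; exists [::], G.
case: x => [A|k|k]; split.
- case=> D [_ [dD /IH [E [F [dE dF ->]]] ->]].
  by exists (D ++ E), F; rewrite catA; split=> //; exists D, E.
- case=> _ [F [[D [E [dD dE ->]]] dF ->]]; exists D, (E ++ F).
  by rewrite catA; split=> //; apply/IH; exists E, F.
- by case=> _ /IH [E [F [dE dF ->]]] ->; exists (Op k :: E), F; split=> //; exists E.
- by case=> _ [F [[E dE ->] dF ->]]; exists (E ++ F) => //; apply/IH; exists E, F.
- by case=> _ /IH [E [F [dE dF ->]]] ->; exists (Cl k :: E), F; split=> //; exists E.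
- by case=> _ [F [[E dE ->] dF ->]]; exists (E ++ F) => //; apply/IH; exists E, F.
Qed.

(** Members of [den A] are balanced, so the substitution does not disturb the
    matching of brackets; this carries the side condition of [cf_boxR] over. *)
Lemma dens_run s G st : dens s G -> run st G = run st s.
Proof.
elim: s G st => [|[A|k|k] s IH] G st /=; first by move=> ->.
- case=> D [E [dD dE ->]]; rewrite run_bal_cat ?(IH _ _ dE) //.
  by case: (den_adequate A) => _ /(_ _ dD) /cfree_bal.
- by case=> E dE ->; rewrite /= (IH _ _ dE).
- by case=> E dE -> /=; case: st => // j st; rewrite (IH _ _ dE).
Qed.

Lemma den_cl_left A Y C l r G :
  (forall D, den A D -> cl Y D) ->
  (forall D E F, dens l D -> Y E -> dens r F -> den C (D ++ E ++ F)) ->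
  dens (l ++ Lf A :: r) G -> den C G.
Proof.
move=> hA h /dens_cat [D [_ [dD [E [F [dE dF ->]]] ->]]].
case: (den_adequate C) => _ _ cC.
by apply: (closed_ctx cC (hA _ dE)) => E' hE'; exact: h.
Qed.

Lemma cfree_sound s A : cfree s A -> forall G, dens s G -> den A G.
Proof.
elim=> {s A}.
- move=> p G /= [D [E [hD -> ->]]]; by rewrite cats0.
- move=> l G r A B C _ IHG _ IHC H /dens_cat [D [_ [dD /dens_cat [E [_ [dE [F [K [dF dK ->]]] ->]]] ->]]].
  apply: IHC; apply/dens_cat; exists D, ((E ++ F) ++ K); split=> //; last by rewrite !catA.
  by exists (E ++ F), K; split=> //; apply: dF; exact: IHG.
- by move=> G A B _ IH H dH D dD; apply: IH => /=; exists D, H.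
- move=> l G r A B C _ IHG _ IHC H /dens_cat [D [_ [dD [E [_ [dE /dens_cat [F [K [dF dK ->]]] ->]]] ->]]].
  apply: IHC; apply/dens_cat; exists D, ((E ++ F) ++ K); split=> //; last by rewrite !catA.
  by exists (E ++ F), K; split=> //; apply: dE; exact: IHG.
- move=> G A B _ IH H dH D dD; apply: IH; apply/dens_cat.
  by exists H, D; split=> //=; exists D, [::]; rewrite cats0.
- move=> l r A B C _ IH G; apply: den_cl_left; first by move=> D; apply.
  move=> D _ F dD [E1 [E2 [dE1 dE2 ->]]] dF; apply: IH; apply/dens_cat.
  exists D, ((E1 ++ E2) ++ F); split=> //=.
  exists E1, (E2 ++ F); split=> //; last by rewrite catA.
  by exists E2, F.
- move=> G D A B _ IHG _ IHD H /dens_cat [E [F [/IHG dE /IHD dF ->]]] l r C h.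
  by apply: h; exists E, F.
- move=> l r k A C _ IH G; apply: den_cl_left; first by move=> D; apply.
  move=> D _ F dD [E dE ->] dF; apply: IH; apply/dens_cat.
  exists D, ((Op k :: E ++ [:: Cl k]) ++ F); split=> //=.
  exists ((E ++ [:: Cl k]) ++ F) => //.
  exists E, (Cl k :: F); split=> //; last by rewrite -catA.
  by exists F.
- move=> k G A _ IH H /= [_ /dens_cat [E [_ [dE [_ -> ->] ->]]] ->] l r C h.
  by apply: h; exists E => //; exact: IH.
- move=> l r k C _ IH G; apply: den_cl_left; first by move=> D; apply.
  move=> D _ F dD -> dF; apply: IH; apply/dens_cat.
  exists D, [:: Op k, Cl k & F]; split=> //=.
  by exists (Cl k :: F) => //; exists F.
- by move=> k G /= [_ [_ -> ->] ->] l r C h; exact: h.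
- move=> l r k A C _ IH G /dens_cat [D [_ [dD /= [_ [E [_ [dE [F dF ->] ->]]] ->] ->]]].
  apply: IH; apply/dens_cat; exists D, ((Op k :: E ++ [:: Cl k]) ++ F).
  split=> //; last by rewrite /= -catA.
  by exists (Op k :: E ++ [:: Cl k]), F; split=> //; case: dE.
- move=> k G A bG _ IH H dH; split; first by rewrite /bal (dens_run _ dH).
  apply: IH => /=; exists (H ++ [:: Cl k]) => //; apply/dens_cat.
  by exists H, [:: Cl k]; split=> //; exists [::].
Qed.

(** Soundness for the left premise puts [G] in [den A], so that [l ++ G ++ r] is
    one of the strings to which soundness applies for the right premise. *)
Theorem cut_admissible l G r A B :
  cfree G A -> cfree (l ++ Lf A :: r) B -> cfree (l ++ G ++ r) B.
Proof.
move=> /cfree_sound /(_ _ (dens_refl G)) dG /cfree_sound h.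
case: (den_adequate B) => _ + _; apply; apply: h; apply/dens_cat.
exists l, (G ++ r); split=> //; [exact: dens_refl|].
by exists G, r; split=> //; exact: dens_refl.
Qed.

(** * Hedges as strings of tokens *)

Fixpoint emb (A : tp) : itp :=
  match A with
  | Prim p => IPrim p
  | LDiv A B => ILDiv (emb A) (emb B)
  | RDiv B A => IRDiv (emb B) (emb A)
  | Prod A B => IProd (emb A) (emb B)
  | Dia A => IDia 0 (emb A)
  | Box A => IBox 0 (emb A)
  end.

Fixpoint flat_tree (t : tree) : seq token :=
  match t with
  | Leaf A => [:: Lf (emb A)]
  | Bracket H => Op 0 :: flatten (map flat_tree H) ++ [:: Cl 0]
  end.

Definition flat (H : hedge) : seq token := flatten (map flat_tree H).

Lemma flat_cat H K : flat (H ++ K) = flat H ++ flat K.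
Proof. by rewrite /flat map_cat flatten_cat. Qed.

Lemma flat_bracket H K :
  flat (Bracket H :: K) = Op 0 :: flat H ++ Cl 0 :: flat K.
Proof. by rewrite /flat /= -catA. Qed.

(** The induction principle generated for trees says nothing about the subtrees
    of a bracket, which sit inside a sequence. *)
Lemma hedge_ind (P : hedge -> Prop) :
  P [::] -> (forall A H, P H -> P (Leaf A :: H)) ->
  (forall K H, P K -> P H -> P (Bracket K :: H)) -> forall H, P H.
Proof.
move=> P0 PL PB.
have: forall n (H : hedge), size (flat H) < n -> P H.
  elim=> // n IH [|[A|K] H] //.
    by move=> lt; apply: PL; apply: IH.
  rewrite flat_bracket /= size_cat /= => lt; apply: PB; apply: IH; lia.
by move=> h H; apply: (h (size (flat H)).+1).
Qed.

Lemma flat_bal H : bal (flat H).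
Proof.
elim/hedge_ind: H => // K H bK bH.
rewrite flat_bracket; suff -> : Op 0 :: flat K ++ Cl 0 :: flat H =
  (Op 0 :: flat K ++ [:: Cl 0]) ++ flat H by apply: bal_cat => //; exact: bal_bracket.
by rewrite /= -catA.
Qed.

Lemma flat_fill C : exists l r, forall H, flat (fill C H) = l ++ flat H ++ r.
Proof.
elim: C => [l r|l C [l' [r' IH]] r].
  by exists (flat l), (flat r) => H; rewrite /= !flat_cat.
exists (flat l ++ Op 0 :: l'), (r' ++ Cl 0 :: flat r) => H.
by rewrite /= flat_cat flat_bracket IH -!catA.
Qed.

Lemma provable_cfree H A : provable H A -> cfree (flat H) (emb A).
Proof.
elim=> {H A} /=.
- by move=> i; exact: cf_ax.
- move=> G A D B C _ IHG _; have [l [r E]] := flat_fill D; rewrite !E flat_cat.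
  by rewrite -catA; exact: cf_ldivL.
- by move=> G A B _ IH; apply: cf_ldivR.
- move=> G A D B C _ IHG _; have [l [r E]] := flat_fill D; rewrite !E.
  by exact: cf_rdivL.
- by move=> G A B _; rewrite flat_cat => IH; apply: cf_rdivR.
- move=> G A B C _; have [l [r E]] := flat_fill G; rewrite !E; exact: cf_prodL.
- by move=> G D A B _ IHG _ IHD; rewrite flat_cat; exact: cf_prodR.
- move=> G A B _; have [l [r E]] := flat_fill G; rewrite !E; exact: cf_diaL.
- by move=> G A _ IH; rewrite flat_bracket; exact: cf_diaR.
- move=> G A B _; have [l [r E]] := flat_fill G; rewrite !E; exact: cf_boxL.
- by move=> G A _ IH; apply: cf_boxR (flat_bal G) _; rewrite flat_bracket in IH.
- move=> G D A B _ IHG _; have [l [r E]] := flat_fill D; rewrite !E.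
  exact: cut_admissible.
Qed.

(** Balanced prefixes of a flattened hedge are cut out between trees, since
    they cannot contain half of a bracket pair. *)
Lemma flat_prefix H X r : flat H = X ++ r -> bal X ->
  exists H1 H2, [/\ H = H1 ++ H2, flat H1 = X & flat H2 = r].
Proof.
elim/hedge_ind: H X => [|A H IH|K H _ IH] X.
- by case: X r => // -[] // _ _; exists [::], [::].
- case: X => [/= <- _|t X]; first by exists [::], (Leaf A :: H).
  case=> <- /IH {}IH /IH [H1 [H2 [-> <- <-]]].
  by exists (Leaf A :: H1), H2.
- rewrite flat_bracket; case: X => [/= <- _|t X].
    by exists [::], (Bracket K :: H); rewrite flat_bracket.
  case=> <- e bX.
  have bK := flat_bal K.
  have no_short e' : flat K = X ++ e' -> False.
    by move=> eK; move: bK bX; rewrite eK => /(bal_no_cross_open 0) /negP.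
  case: (cat_eq_cat e) => [[e' [eK _]]|[[|t' X'] [eX er]]].
  + by case: (no_short e').
  + by case: (no_short [::]); rewrite eX !cats0.
  + move: er eX => [<-] eH eX.
    have bX' : bal X'.
      by move: bX; rewrite /bal eX /= run_bal_cat.
    have [H1 [H2 [-> h1 h2]]] := IH _ eH bX'.
    by exists (Bracket K :: H1), H2; rewrite flat_bracket h1 eX.
Qed.

Definition ctx_cons (t : tree) (C : context) : context :=
  match C with
  | Hole l r => Hole (t :: l) r
  | Inside l C' r => Inside (t :: l) C' r
  end.

Lemma fill_ctx_cons t C H : fill (ctx_cons t C) H = t :: fill C H.
Proof. by case: C. Qed.

(** Likewise for balanced substrings, which therefore sit in contexts of
    hedges; this is how the rules on strings become rules on hedges. *)
Lemma flat_split H l X r : flat H = l ++ X ++ r -> bal X ->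
  exists C K, [/\ H = fill C K, flat K = X &
    forall K', flat (fill C K') = l ++ flat K' ++ r].
Proof.
move=> + bX.
have base K r' : flat K = X ++ r' -> exists C K0, [/\ K = fill C K0, flat K0 = X &
    forall K', flat (fill C K') = flat K' ++ r'].
  move=> /flat_prefix /(_ bX) [H1 [H2 [-> <- <-]]].
  by exists (Hole [::] H2), H1; split=> // K'; rewrite /= flat_cat.
elim/hedge_ind: H l r => [|A H IH|K H IHK IH] [|t l] r; try exact: base.
- by [].
- case=> <- /IH [C [K [-> <- hC]]].
  exists (ctx_cons (Leaf A) C), K; rewrite fill_ctx_cons; split=> // K'.
  by rewrite fill_ctx_cons /= -hC.
- rewrite flat_bracket => -[<- e].
  have bK := flat_bal K.
  have inner d d' : flat K = l ++ d -> d = X ++ d' -> r = d' ++ Cl 0 :: flat H ->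
      exists C K0, [/\ Bracket K :: H = fill C K0, flat K0 = X &
        forall K', flat (fill C K') = (Op 0 :: l) ++ flat K' ++ r].
    move=> eK ed er; rewrite ed in eK; have [C [K0 [-> <- hC]]] := IHK _ _ eK.
    exists (Inside [::] C H), K0; split=> // K'.
    by rewrite flat_bracket hC er /= -!catA.
  case: (cat_eq_cat e) => [[d [eK er]]|[[|t' l'] [el er]]].
  + case: (cat_eq_cat er) => [[[|c X'] [eX eH]]|[d' [ed eH]]].
    * by apply: (inner d [::]); rewrite // eX !cats0.
    * case: eH => ec _; rewrite -ec in eX.
      by move: bX bK; rewrite eX eK => + /bal_no_cross_close /negP; move=> /[swap] /[apply].
    * exact: inner eK ed eH.
  + have [eX|[x [X' eX]]] : X = [::] \/ exists x X', X = x :: X'.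
        by case: (X) => [|x X']; [left | right; exists x, X'].
      by apply: (inner [::] [::]); rewrite ?el ?cats0 ?eX //; move: er; rewrite eX.
    by move: bX er; rewrite eX => + [ex]; rewrite -ex.
  + case: er el => <- /IH [C [K0 [-> <- hC]]] el.
    exists (ctx_cons (Bracket K) C), K0; rewrite fill_ctx_cons; split=> // K'.
    by rewrite fill_ctx_cons flat_bracket hC el /= -!catA.
Qed.

Lemma flat_nil H : flat H = [::] -> H = [::].
Proof. by case: H => [|[A|K] H]. Qed.

Lemma flat_Lf H A : flat H = [:: Lf A] -> exists2 a, A = emb a & H = [:: Leaf a].
Proof.
by case: H => [|[a|K] [|[b|K'] H]] // [<-]; exists a.
Qed.

(** By the subformula property, a derivation of a sequent without [IDia1] and with
    all indices 0 never leaves the original calculus. *)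
Lemma cfree_provable s A H a :
  cfree s A -> flat H = s -> emb a = A -> provable H a.
Proof.
move=> d; elim: d H a => {s A}.
- move=> p H a /flat_Lf [b eb ->].
  by case: b eb a => // q [->] [] // i [->]; exact: ax.
- move=> l G r A B C dG IHG _ IHC H c eH ec.
  have bG := cfree_bal dG.
  have bX : bal (G ++ [:: Lf (ILDiv A B)]) by rewrite bal_cat.
  have [|D [K [-> eK hD]]] := @flat_split H l _ r _ bX; first by rewrite -catA.
  have [K1 [K2 [-> e1 /flat_Lf [b eb ->]]]] := flat_prefix eK bG.
  case: b eb => // a b [ea eb]; apply: ldivL; first exact: IHG.
  by apply: IHC => //; rewrite hD eb.
- move=> G A B _ IH H [] // a b eH [ea eb]; apply: ldivR; apply: IH => //.
  by rewrite -ea -eH.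
- move=> l G r A B C dG IHG _ IHC H c eH ec.
  have bG := cfree_bal dG.
  have bX : bal (Lf (IRDiv B A) :: G) by [].
  have [|D [K [-> eK hD]]] := @flat_split H l _ r _ bX; first by [].
  have [K1 [K2 [-> /flat_Lf [b eb ->] e2]]] := @flat_prefix K [:: Lf (IRDiv B A)] G eK isT.
  case: b eb => // b a [eb ea]; apply: rdivL; first exact: IHG.
  by apply: IHC => //; rewrite hD eb.
- move=> G A B _ IH H [] // b a eH [eb ea]; apply: rdivR; apply: IH => //.
  by rewrite flat_cat -ea -eH.
- move=> l r A B C _ IH H c eH ec.
  have [D [K [-> /flat_Lf [b eb ->] hD]]] := @flat_split H l [:: _] r eH isT.
  by case: b eb => // a b [ea eb]; apply: prodL; apply: IH => //; rewrite hD ea eb.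
- move=> G D A B dG IHG _ IHD H [] // a b eH [ea eb].
  have [K1 [K2 [-> e1 e2]]] := flat_prefix eH (cfree_bal dG).
  by apply: prodR; [exact: IHG | exact: IHD].
- move=> l r k A C _ IH H c eH ec.
  have [D [K [-> /flat_Lf [b eb ->] hD]]] := @flat_split H l [:: _] r eH isT.
  by case: b eb => // a [ek ea]; apply: diaL; apply: IH => //; rewrite hD ea ek.
- move=> k G A dG IH H [] // a eH [ek ea].
  case: H eH => [|[b|K] H] //; rewrite flat_bracket => -[_ e].
  have [eK eH] := bal_close_inj (flat_bal K) (cfree_bal dG) e.
  by rewrite (flat_nil eH); apply: diaR; exact: IH.
- move=> l r k C _ IH H c eH ec.
  by have [D [K [_ /flat_Lf [[]]]]] := @flat_split H l [:: _] r eH isT.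
- by move=> k H [].
- move=> l r k A C _ IH H c eH ec.
  have [D [K [-> eK hD]]] := @flat_split H l [:: Op k; _; Cl k] r eH (bal_bracket k (isT : bal [:: Lf (IBox k A)])).
  case: K eK => [|[b|K] K'] //; rewrite flat_bracket => -[_ e].
  have [/flat_Lf [b eb ->] /flat_nil ->] :=
    @bal_close_inj (flat K) [:: Lf (IBox k A)] _ _ _ _ (flat_bal K) isT e.
  by case: b eb => // a [_ ea]; apply: boxL; apply: IH => //; rewrite hD ea.
- move=> k G A bG _ IH H [] // a eH [ek ea]; apply: boxR; apply: IH => //.
  by rewrite flat_bracket eH ek.
Qed.

(** * Words of types and sequents *)

(** A generator of the free group is a pair of a kind (primitive type, opening
    or closing bracket) and a name; the boolean tells it from its inverse. *)
Definition letter : Type := (bool * (nat * nat))%type.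

Definition flip (x : letter) : letter := (~~ x.1, x.2).

Lemma flipK : involutive flip.
Proof. by case=> -[] n. Qed.

Lemma flip_neq x : (flip x == x) = false.
Proof. by case: x => -[] n; apply/eqP. Qed.

Lemma flip_eq x y : (flip x == y) = (x == flip y).
Proof. by apply/eqP/eqP => [<-|->]; rewrite flipK. Qed.

Definition inv (w : seq letter) : seq letter := rev (map flip w).

Lemma inv_cat u v : inv (u ++ v) = inv v ++ inv u.
Proof. by rewrite /inv map_cat rev_cat. Qed.

Lemma inv_cons x u : inv (x :: u) = inv u ++ [:: flip x].
Proof. by rewrite -cat1s inv_cat. Qed.

Lemma invK : involutive inv.
Proof.
move=> w; rewrite /inv map_rev revK -map_comp -[RHS]map_id.
by apply: eq_map; exact: flipK.
Qed.

Lemma count_inv x w : count_mem x (inv w) = count_mem (flip x) w.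
Proof.
rewrite /inv count_rev count_map; apply: eq_count => y /=.
by rewrite flip_eq.
Qed.

Lemma mem_inv x w : (x \in inv w) = (flip x \in w).
Proof. by rewrite -!has_pred1 !has_count count_inv. Qed.

Lemma size_inv w : size (inv w) = size w.
Proof. by rewrite size_rev size_map. Qed.

Definition atm p : letter := (true, (0, p)).
Definition opn k : letter := (true, (1, k)).
Definition cls k : letter := (true, (2, k)).

(** The interpretation of types in the free group, as unreduced words: division
    is multiplication by the inverse, and a diamond encloses the word between two
    generators, which a box takes away. *)
Fixpoint wty (A : itp) : seq letter :=
  match A with
  | IPrim p => [:: atm p]
  | ILDiv A B => inv (wty A) ++ wty B
  | IRDiv B A => wty B ++ inv (wty A)
  | IProd A B => wty A ++ wty B
  | IDia k A => opn k :: wty A ++ [:: cls k]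
  | IBox k A => flip (opn k) :: wty A ++ [:: flip (cls k)]
  | IDia1 k => [:: opn k; cls k]
  end.

Definition wtok (t : token) : seq letter :=
  match t with Lf A => wty A | Op k => [:: opn k] | Cl k => [:: cls k] end.

Definition wd (s : seq token) : seq letter := flatten (map wtok s).

Lemma wd_cat s t : wd (s ++ t) = wd s ++ wd t.
Proof. by rewrite /wd map_cat flatten_cat. Qed.

Lemma wd_cons t s : wd (t :: s) = wtok t ++ wd s.
Proof. by []. Qed.

Lemma wd1 t : wd [:: t] = wtok t.
Proof. by rewrite wd_cons cats0. Qed.

(** The words that reduce to the empty word, generated by inserting pairs of
    inverse letters. *)
Inductive red : seq letter -> Prop :=
  | red_nil : red [::]
  | red_ins u v x : red (u ++ v) -> red (u ++ x :: flip x :: v).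

Lemma red_insert w u v : red w -> red (u ++ v) -> red (u ++ w ++ v).
Proof.
move=> rw; elim: rw u v => {w} [|a b x _ IH] u v //= ruv.
by move: (IH u v ruv); rewrite -!catA !cat_cons !(catA u); exact: red_ins.
Qed.

Lemma red_conj w x : red w -> red (x :: w ++ [:: flip x]).
Proof.
by move=> rw; apply: (@red_insert w [:: x] [:: flip x]) => //; exact: (@red_ins [::] [::]) red_nil.
Qed.

Lemma red_rot u v : red (u ++ v) -> red (v ++ u).
Proof.
move e: (u ++ v) => w rw; elim: rw u v e => {w} [|a b x rab IH] u v.
  by case: u v => // -[] // _; exact: red_nil.
move=> e; case: (cat_eq_cat e) => [[[|y [|z d]] [-> ed]]|[d [ea ->]]].
- rewrite /= in ed; rewrite cats0 -ed; apply: (@red_ins [::]); exact: (IH a b).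
- case: ed => <- <-; rewrite catA; have := red_conj (flip x) (IH a b erefl).
  by rewrite flipK.
- case: ed => <- <- eb; rewrite catA; apply: red_ins; rewrite -catA.
  by apply: IH; rewrite eb catA.
- rewrite -catA; apply: red_ins; rewrite catA; apply: IH.
  by rewrite ea catA.
Qed.

Lemma red_inv_r w : red (w ++ inv w).
Proof.
elim: w => [|x w IH]; first exact: red_nil.
by rewrite inv_cons catA; exact: red_conj.
Qed.

Lemma red_count w x : red w -> count_mem x w = count_mem (flip x) w.
Proof.
elim=> // u v y _; rewrite !count_cat /= !flip_eq flipK; lia.
Qed.

Lemma red_mate w x : red w -> x \in w -> flip x \in w.
Proof. by move=> /red_count rw; rewrite -!has_pred1 !has_count rw. Qed.

(** The group axioms validate each rule: divisions multiply by inverses, and a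
    bracket pair multiplies by a generator on either side. *)
Lemma cfree_red s A : cfree s A -> red (wd s ++ inv (wty A)).
Proof.
elim=> {s A}.
- by move=> p; exact: (red_inv_r [:: atm p]).
- move=> l G r A B C _ IHG _; rewrite !wd_cat !wd_cons /= -!catA => IHC.
  by have := red_insert IHG IHC; rewrite -!catA.
- move=> G A B _; rewrite wd_cons /= -catA => /red_rot.
  by rewrite inv_cat invK catA.
- move=> l G r A B C _ /red_rot IHG _; rewrite !(wd_cat, wd_cons) /= -!catA => IHC.
  by have := @red_insert _ (wd l ++ wty B) (wd r ++ inv (wty C)) IHG; rewrite -!catA; apply.
- by move=> G A B _; rewrite wd_cat wd1 /= inv_cat invK -!catA.
- by move=> l r A B C _; rewrite !(wd_cat, wd_cons) /= -!catA.
- move=> G D A B _ IHG _ IHD; rewrite wd_cat inv_cat -catA.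
  by have := red_insert IHD IHG; rewrite -!catA.
- by move=> l r k A C _; rewrite !(wd_cat, wd_cons) /= -!catA.
- move=> k G A _ /(red_conj (opn k)) h.
  suff -> : wd (Op k :: G ++ [:: Cl k]) ++ inv (wty (IDia k A)) = (opn k :: wd G) ++
      [:: cls k, flip (cls k) & inv (wty A) ++ [:: flip (opn k)]].
    by apply: red_ins; rewrite /= catA.
  by rewrite wd_cons wd_cat wd1 /= inv_cons inv_cat -!catA.
- by move=> l r k C _; rewrite !(wd_cat, wd_cons) /= -!catA.
- by move=> k; exact: (red_inv_r (wd [:: Op k; Cl k])).
- move=> l r k A C _ h.
  suff -> : wd (l ++ [:: Op k, Lf (IBox k A), Cl k & r]) ++ inv (wty C) =
      wd l ++ [:: opn k, flip (opn k) & wty A ++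
        [:: flip (cls k), flip (flip (cls k)) & wd r ++ inv (wty C)]].
    apply: red_ins; rewrite catA; apply: red_ins; rewrite -catA.
    by move: h; rewrite wd_cat wd_cons -!catA.
  by rewrite flipK wd_cat !wd_cons /= -!catA /= -!catA.
- move=> k G A _ _; rewrite wd_cons wd_cat /= => /(@red_rot [:: _]).
  by rewrite inv_cons inv_cat /inv /= !flipK -!catA.
Qed.

Lemma uniq_cat_inj (T : eqType) (z : T) a b c d :
  uniq (a ++ z :: b) -> a ++ z :: b = c ++ z :: d -> a = c /\ b = d.
Proof.
move=> + e; case: (cat_eq_cat e) => [[[|x f] []]|[[|x f] []]].
- by rewrite cats0 => -> [->].
- by move=> -> [<- _]; rewrite -catA cat_uniq /= mem_cat inE eqxx orbT /= !andbF.
- by rewrite cats0 => -> [->].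
- by move=> _ [_ ->]; rewrite cat_uniq /= mem_cat inE eqxx orbT /= !andbF.
Qed.

(** In a reduction of [w] to the empty word each letter is cancelled against its
    mate, since it has no other candidate, so what lies between the two has to
    cancel first.  The induction removes the pair inserted last: it is adjacent
    in [w], hence lies on one side of [x] or is the pair of [x] itself. *)
Lemma red_noncrossing w : red w -> uniq w -> forall U x V Z,
  w = U ++ x :: V ++ flip x :: Z -> forall y, y \in V -> flip y \in V.
Proof.
elim=> [_ [|? ?] //|u v z _ IH uw U x V Z e y yV].
have uw' := uw; rewrite e in uw'.
have [xz|xz] := eqVneq x z.
  move: e uw'; rewrite xz => e _; have [_ e'] := uniq_cat_inj uw e.
  move: uw; rewrite cat_uniq => /and3P[_ _ /= /andP[_ uw]].
  have [] := @uniq_cat_inj _ (flip z) [::] v V Z; by [|move=> eV; rewrite -eV in yV].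
have [xz'|xz'] := eqVneq x (flip z).
  move: e; rewrite xz' flipK => e.
  have [_ ev] : u ++ [:: z] = U /\ v = V ++ z :: Z.
    by apply: (@uniq_cat_inj _ (flip z)); rewrite -catA.
  by move: uw; rewrite ev cat_uniq /= !(mem_cat, inE) eqxx !orbT !andbF.
have xz'' : flip x != z by rewrite flip_eq.
have xz3 : flip x != flip z by rewrite flip_eq flipK.
have [yz|yz] := eqVneq y z.
  case/splitPr: yV e => V1 V2; rewrite yz => e.
  have [_] : u = U ++ x :: V1 /\ flip z :: v = V2 ++ flip x :: Z.
    by apply: (uniq_cat_inj uw); rewrite e -!catA /= -?catA.
  case: V2 {e} => [|t V2] /(congr1 (head z)) /= ez; first by rewrite ez eqxx in xz3.
  by rewrite mem_cat !inE -ez eqxx !orbT.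
have [yz'|yz'] := eqVneq y (flip z).
  case/splitPr: yV e => V1 V2; rewrite yz' flipK => e.
  have [] : u ++ [:: z] = U ++ x :: V1 /\ v = V2 ++ flip x :: Z.
    by apply: (@uniq_cat_inj _ (flip z)); rewrite -!catA //= e -?catA.
  case/lastP: V1 {e} => [|V1 t].
    rewrite !cats1 => /rcons_inj [_ ezx]; by rewrite ezx eqxx in xz.
  rewrite cats1 -rcons_cons -rcons_cat => /rcons_inj [_ <-] _.
  by rewrite mem_cat mem_rcons inE eqxx.
(* Removing the adjacent pair leaves a word of the same shape around [x]. *)
pose P := [pred t | (t != z) && (t != flip z)].
have := uw; rewrite (uniq_catCA u [:: z; flip z] v) cat_uniq => /and3P[_ zuv uuv].
have [zu zv] : z \notin u ++ v /\ flip z \notin u ++ v.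
  by move: zuv; rewrite -all_predC; split; apply/negP => /(allP zuv) /=; rewrite !inE eqxx ?orbT.
have eP : filter P (u ++ v) = u ++ v.
  apply/all_filterP/allP => t tuv /=; apply/andP.
  by split; [apply: contraNneq zu => <- | apply: contraNneq zv => <-].
have e' : u ++ v = filter P U ++ x :: filter P V ++ flip x :: filter P Z.
  rewrite -eP; have <- : filter P (u ++ z :: flip z :: v) = filter P (u ++ v).
    by rewrite !filter_cat /= !eqxx /= andbF.
  by rewrite e !filter_cat /= xz xz' /= filter_cat /= xz'' xz3.
by have := IH uuv _ _ _ _ e' y; rewrite !mem_filter yV /= yz yz' => /(_ isT) /andP[].
Qed.

(** * Interpolation *)

Definition occ (x : letter) (A : itp) : nat := count_mem x (wty A).
Definition occs (x : letter) (s : seq token) : nat := count_mem x (wd s).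

Lemma occs_cat x s t : occs x (s ++ t) = occs x s + occs x t.
Proof. by rewrite /occs wd_cat count_cat. Qed.

Lemma occs_Lf x A s : occs x (Lf A :: s) = occ x A + occs x s.
Proof. by rewrite /occs wd_cons count_cat. Qed.

Lemma occs_Op x k s : occs x (Op k :: s) = (opn k == x) + occs x s.
Proof. by rewrite /occs wd_cons count_cat /= addn0. Qed.

Lemma occs_Cl x k s : occs x (Cl k :: s) = (cls k == x) + occs x s.
Proof. by rewrite /occs wd_cons count_cat /= addn0. Qed.

Lemma occs_nil x : occs x [::] = 0.
Proof. by []. Qed.

Lemma occ_ldiv x A B : occ x (ILDiv A B) = occ (flip x) A + occ x B.
Proof. by rewrite /occ count_cat count_inv. Qed.

Lemma occ_rdiv x A B : occ x (IRDiv B A) = occ x B + occ (flip x) A.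
Proof. by rewrite /occ count_cat count_inv. Qed.

Lemma occ_prod x A B : occ x (IProd A B) = occ x A + occ x B.
Proof. by rewrite /occ count_cat. Qed.

Lemma occ_dia x k A : occ x (IDia k A) = (opn k == x) + (occ x A + (cls k == x)).
Proof. by rewrite /occ /= count_cat /= addn0. Qed.

Lemma occ_box x k A :
  occ x (IBox k A) = (opn k == flip x) + (occ x A + (cls k == flip x)).
Proof. by rewrite /occ /= count_cat /= addn0 !flip_eq. Qed.

Lemma occ_dia1 x k : occ x (IDia1 k) = (opn k == x) + (cls k == x).
Proof. by rewrite /occ /= addn0. Qed.

Definition occE := (occs_cat, occs_Lf, occs_Op, occs_Cl, occs_nil, occ_ldiv,
  occ_rdiv, occ_prod, occ_dia, occ_box, occ_dia1, flipK).

(** The letters of [B], counted with multiplicity and sign, have to be found in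
    [D], and with opposite sign in the surroundings of [D]; in [C], which is on
    the other side of the arrow, the sign is the same. *)
Definition interpolant l D r C B : Prop :=
  [/\ cfree D B, cfree (l ++ Lf B :: r) C, forall x, occ x B <= occs x D
    & forall x, occ x B <= occs (flip x) l + occs (flip x) r + occ x C].

Definition interpolable l D r C : Prop := exists B, interpolant l D r C B.

Ltac occ_lia :=
  let x := fresh "x" in
  move=> x;
  repeat match goal with
  | H : forall y, is_true (occ y _ <= _) |- _ =>
      move: (H x) (H (flip x)); clear H
  end;
  rewrite ?occE; lia.

(** The next four lemmas are the cases in which the piece contains part of the
    argument [G] of a division.  If it also contains the division, but only the
    near end of [G], the interpolant of the missing part of [G] becomes the
    argument of a new division; if it contains the far end of [G] and some of
    the context, the two interpolants are multiplied.  Either part may be empty,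
    and then it has no interpolant (this would be the unit) and needs none. *)
Lemma interpolable_prod_ldiv l d M1 M2 r A B C :
  cfree (M1 ++ M2) A -> cfree (l ++ d ++ Lf B :: r) C ->
  (d <> [::] -> interpolable l d (Lf B :: r) C) ->
  (M1 <> [::] -> interpolable [::] M1 M2 A) ->
  d ++ M1 <> [::] -> interpolable l (d ++ M1) (M2 ++ Lf (ILDiv A B) :: r) C.
Proof.
move=> dA dC; case: d dC => [|t d] dC; case: M1 dA => [|u M] dA // hd hM _.
- have [|E [h1 h2 h3 h4]] := hM; first by [].
  exists E; split=> //; last by occ_lia.
  by have := cf_ldivL h2 dC; rewrite /= -?catA.
- have [|E [h1 h2 h3 h4]] := hd; first by [].
  exists E; split=> //; rewrite ?cats0 //; last by occ_lia.
  by have := @cf_ldivL (l ++ [:: Lf E]) M2 r A B C dA; rewrite -?catA; apply.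
- have [|E [h1 h2 h3 h4]] := hd; first by [].
  have [|F [k1 k2 k3 k4]] := hM; first by [].
  exists (IProd E F); split; [exact: cf_prodR| |by occ_lia|by occ_lia].
  apply: cf_prodL; have := @cf_ldivL (l ++ [:: Lf E]) _ r A B C k2.
  by rewrite -?catA; apply.
Qed.

Lemma interpolable_div_ldiv l M1 M2 f r A B C :
  cfree (M1 ++ M2) A -> interpolable l (Lf B :: f) r C ->
  (M1 <> [::] -> interpolable [::] M1 M2 A) ->
  interpolable (l ++ M1) (M2 ++ Lf (ILDiv A B) :: f) r C.
Proof.
move=> dA [F [k1 k2 k3 k4]]; case: M1 dA => [|t M] dA hM.
  exists F; rewrite cats0; split=> //; last by occ_lia.
  by have := @cf_ldivL [::] _ _ _ _ _ dA k1.
have [|E [h1 h2 h3 h4]] := hM; first by [].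
exists (ILDiv E F); split; [| |by occ_lia|by occ_lia].
  by apply: cf_ldivR; have := @cf_ldivL [::] _ _ _ _ _ h2 k1.
by rewrite -catA; exact: cf_ldivL h1 k2.
Qed.

Lemma interpolable_prod_rdiv l M1 M2 f r A B C :
  cfree (M1 ++ M2) A -> cfree (l ++ Lf B :: f ++ r) C ->
  (f <> [::] -> interpolable (l ++ [:: Lf B]) f r C) ->
  (M2 <> [::] -> interpolable M1 M2 [::] A) ->
  M2 ++ f <> [::] -> interpolable (l ++ Lf (IRDiv B A) :: M1) (M2 ++ f) r C.
Proof.
move=> dA dC; case: f dC => [|t f] dC; case: M2 dA => [|u M] dA // hf hM _.
- have [|E [h1 h2 h3 h4]] := hM; first by [].
  exists E; rewrite cats0; split=> //; last by occ_lia.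
  by have := cf_rdivL h2 dC; rewrite -?catA.
- have [|E [h1 h2 h3 h4]] := hf; first by [].
  exists E; split=> //; last by occ_lia.
  rewrite cats0 in dA; rewrite -catA in h2.
  by have := @cf_rdivL l _ _ _ _ _ dA h2; rewrite -?catA.
- have [|E [h1 h2 h3 h4]] := hf; first by [].
  have [|F [k1 k2 k3 k4]] := hM; first by [].
  exists (IProd F E); split; [exact: cf_prodR| |by occ_lia|by occ_lia].
  apply: cf_prodL; rewrite -catA in h2; have := @cf_rdivL l _ _ _ _ _ k2 h2.
  by rewrite -?catA.
Qed.

Lemma interpolable_div_rdiv l d M1 M2 r A B C :
  cfree (M1 ++ M2) A -> interpolable l (d ++ [:: Lf B]) r C ->
  (M2 <> [::] -> interpolable M1 M2 [::] A) ->
  interpolable l (d ++ Lf (IRDiv B A) :: M1) (M2 ++ r) C.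
Proof.
move=> dA [F [k1 k2 k3 k4]]; case: M2 dA => [|t M] dA hM.
  rewrite cats0 in dA; exists F; split=> //; last by occ_lia.
  by have := @cf_rdivL d _ [::] _ _ _ dA k1; rewrite cats0.
have [|E [h1 h2 h3 h4]] := hM; first by [].
exists (IRDiv F E); split; [| |by occ_lia|by occ_lia].
  by apply: cf_rdivR; have := @cf_rdivL d _ [::] _ _ _ h2 k1; rewrite cats0 -?catA.
exact: cf_rdivL h1 k2.
Qed.

Lemma interpolable_prodR l D1 D2 r A B :
  cfree (l ++ D1) A -> cfree (D2 ++ r) B ->
  (D1 <> [::] -> interpolable l D1 [::] A) ->
  (D2 <> [::] -> interpolable [::] D2 r B) ->
  D1 ++ D2 <> [::] -> interpolable l (D1 ++ D2) r (IProd A B).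
Proof.
case: D1 => [|t D1]; case: D2 => [|u D2] // dA dB h1 h2 _.
- have [|E [k1 k2 k3 k4]] := h2; first by [].
  rewrite cats0 in dA.
  by exists E; split=> //; [exact: cf_prodR dA k2 | occ_lia].
- have [|E [k1 k2 k3 k4]] := h1; first by [].
  exists E; rewrite cats0; split=> //; [|occ_lia].
  by have := cf_prodR k2 dB; rewrite -catA.
- have [|E [k1 k2 k3 k4]] := h1; first by [].
  have [|F [n1 n2 n3 n4]] := h2; first by [].
  exists (IProd E F); split; [exact: cf_prodR| |by occ_lia|by occ_lia].
  by apply: cf_prodL; have := cf_prodR k2 n2; rewrite -catA.
Qed.

Lemma split_singleton (t : token) l D r :
  [:: t] = l ++ D ++ r -> D <> [::] -> [/\ l = [::], D = [:: t] & r = [::]].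
Proof.
case: l => [|x [|? ?]] //=; last by case: D.
by case: D => [|x [|? ?]] // [->]; case: r.
Qed.

Lemma split_bracket k G l D r :
  bal G -> bal D -> D <> [::] -> Op k :: G ++ [:: Cl k] = l ++ D ++ r ->
  [/\ l = [::], r = [::] & D = Op k :: G ++ [:: Cl k]] \/
  exists l' r', [/\ l = Op k :: l', r = r' ++ [:: Cl k] & G = l' ++ D ++ r'].
Proof.
move=> bG bD nD; case: l => [|x l] /=.
  case: D nD bD => // x D _ bD [ex e]; rewrite -{x}ex in bD *; case/lastP: r e => [|r y].
    by rewrite cats0 => <-; left.
  rewrite cats1 -rcons_cat => /rcons_inj [eG _]; rewrite eG in bG.
  by move: bD; rewrite (negPf (bal_no_cross_open k bG)).
case=> <- e; case/lastP: r e => [|r y].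
  case/lastP: D nD bD => // D y _ bD; rewrite cats0 cats1 -rcons_cat => /rcons_inj [eG ey].
  by move: bD; rewrite -ey -cats1; rewrite eG in bG; rewrite (negPf (bal_no_cross_close _ _ bG)).
rewrite cats1 -!rcons_cat => /rcons_inj [-> <-]; right; exists l, r.
by rewrite cats1.
Qed.

Lemma bal_open_end d k : bal (d ++ [:: Op k]) = false.
Proof. by rewrite /bal run_cat; case: (run [::] d). Qed.

Inductive block_split (l T r l0 D r0 : seq token) : Prop :=
  | BlockLeft e of l = l0 ++ D ++ e & r0 = e ++ T ++ r
  | BlockRight e of r = e ++ D ++ r0 & l0 = l ++ T ++ e
  | BlockInside d f of l = l0 ++ d & r = f ++ r0 & D = d ++ T ++ f.

Lemma split_token l (t : token) r l0 D r0 :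
  l ++ t :: r = l0 ++ D ++ r0 -> D <> [::] -> block_split l [:: t] r l0 D r0.
Proof.
move=> e nD; case: (cat_eq_cat e) => [[d [el e1]]|[[|x d] [el e1]]].
- case: (cat_eq_cat e1) => [[[|x f] [eD e2]]|[f [ed e2]]].
  + by apply: (@BlockLeft _ _ _ _ _ _ [::]); rewrite ?el ?eD ?cats0.
  + by case: e2 eD => <- -> eD; apply: (@BlockInside _ _ _ _ _ _ d f).
  + by apply: (@BlockLeft _ _ _ _ _ _ f); rewrite ?el ?ed.
- case: D nD e1 {e} => [|x D] // _ [<- er].
  by apply: (@BlockInside _ _ _ _ _ _ [::] D); rewrite ?el ?cats0.
- by case: e1 el => <- -> el; apply: (@BlockRight _ _ _ _ _ _ d).
Qed.

(** A left rule replaces a block [X] of the premise by [T]; when the piece does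
    not cut [T], the interpolant in the premise remains one. *)
Lemma interpolable_block X T l r C l0 D r0 :
  bal X -> bal T -> X <> [::] -> (forall x, occs x X <= occs x T) ->
  (forall l r C, cfree (l ++ X ++ r) C -> cfree (l ++ T ++ r) C) ->
  (forall l0 D r0, l ++ X ++ r = l0 ++ D ++ r0 -> bal D -> D <> [::] ->
     interpolable l0 D r0 C) ->
  bal D -> D <> [::] -> block_split l T r l0 D r0 -> interpolable l0 D r0 C.
Proof.
move=> bX bT nX hX XT IH bD nD [e el er|e er el|d f el er eD].
- have [F [k1 k2 k3 k4]] : interpolable l0 D (e ++ X ++ r) C.
    by apply: IH; rewrite // el -?catA.
  exists F; rewrite er; split=> // [|x].
    by move: k2; rewrite -cat_rcons catA => /XT; rewrite -catA cat_rcons.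
  by move: (k4 x) (hX (flip x)); rewrite !occE; lia.
- have [F [k1 k2 k3 k4]] : interpolable (l ++ X ++ e) D r0 C.
    by apply: IH; rewrite // er -?catA.
  exists F; rewrite el; split=> // [|x].
    by move: k2; rewrite -!catA => /XT.
  by move: (k4 x) (hX (flip x)); rewrite !occE; lia.
- have [F [k1 k2 k3 k4]] : interpolable l0 (d ++ X ++ f) r0 C.
    apply: IH; rewrite ?el ?er -?catA //; last by case: (d) nX; case: (X).
    by rewrite (bal_splice _ _ bX bT) -eD.
  exists F; split=> // [|x]; first by rewrite eD; apply: XT.
  by move: (k3 x) (hX x); rewrite eD !occE; lia.
Qed.

(** Maehara's method: induction on the cut-free derivation.  Empty pieces are
    excluded because their interpolant would be the unit. *)
Theorem interpolation s C :
  cfree s C -> forall l D r, s = l ++ D ++ r -> bal D -> D <> [::] ->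
  interpolable l D r C.
Proof.
elim=> {s C}.
- move=> p l D r e _ /(split_singleton e) [-> -> ->].
  by exists (IPrim p); split=> //; try exact: cf_ax; occ_lia.
- move=> l G r A B C dG IHG dC IHC l0 D r0 e bD nD.
  have bG := cfree_bal dG.
  have block : block_split l (G ++ [:: Lf (ILDiv A B)]) r l0 D r0 -> interpolable l0 D r0 C.
    apply: (@interpolable_block [:: Lf B]) => //; first by rewrite bal_cat.
      by move=> x; rewrite !occE; lia.
    by move=> l' r' C' h; rewrite -catA; exact: cf_ldivL dG h.
  case: (cat_eq_cat e) => [[d [el e1]]|[d [el e1]]].
  + case: (cat_eq_cat e1) => [[d' [eD e2]]|[d' [ed e2]]].
    * (* The piece starts in the context and ends inside [G]. *)
      have base M2 : G = d' ++ M2 -> r0 = M2 ++ Lf (ILDiv A B) :: r -> interpolable l0 D r0 C.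
        move=> eG ->; rewrite eG in bG; rewrite eD in bD.
        have [b1 b2 _] := bal_overlap bD bG.
        rewrite eD; apply: interpolable_prod_ldiv; rewrite -?eG -?eD //.
        - by rewrite catA -el.
        - by move=> nd; apply: IHC; rewrite // el -?catA.
        - by move=> nd'; apply: IHG.
      case: (cat_eq_cat e2) => [[M2 [eG er0]]|[[|x f] [ed' e3]]].
      - exact: base eG er0.
      - by apply: (base [::]); rewrite ?cats0 // ed' cats0.
      - case: e3 ed' => <- er ed'; apply: block.
        by apply: (@BlockInside _ _ _ _ _ _ d f); rewrite // eD ed' -?catA.
    * by apply: block; apply: (@BlockLeft _ _ _ _ _ _ d'); rewrite ?el ?ed // e2 -?catA.
  + (* The piece starts inside [G] and contains the division. *)
    have base M2 f : G = d ++ M2 -> D = M2 ++ Lf (ILDiv A B) :: f -> r = f ++ r0 ->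
      interpolable l0 D r0 C.
      move=> eG eD er; rewrite eG in bG; rewrite eD in bD.
      have [b1 b2 b3] := bal_overlap bG bD.
      rewrite eD el; apply: interpolable_div_ldiv; first by rewrite -eG.
        by apply: IHC; rewrite // er.
      by move=> nd; apply: IHG.
    have inner M2 : G = d ++ D ++ M2 -> r0 = M2 ++ Lf (ILDiv A B) :: r -> interpolable l0 D r0 C.
      move=> eG ->; have [F [k1 k2 k3 k4]] := IHG _ _ _ eG bD nD.
      exists F; rewrite el; split=> //; last by occ_lia.
      by have := cf_ldivL k2 dC; rewrite -?catA.
    case: (cat_eq_cat e1) => [[M [eG e2]]|[[|x f] [ed e2]]].
    * case: (cat_eq_cat e2) => [[[|x f] [eM e3]]|[f [eM e3]]].
      - by apply: (inner [::]); rewrite // eG eM ?cats0.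
      - by case: e3 => ex er; apply: (base M f); rewrite // ex.
      - by apply: (inner f); rewrite // eG eM.
    * case: D nD bD base inner block e e1 e2 => [|x D] // nD bD base inner _ _ _ [ex er].
      by apply: (base [::] D); rewrite ?cats0 // ?ex ?ed ?cats0.
    * case: e2 ed => <- er ed; apply: block.
      by apply: (@BlockRight _ _ _ _ _ _ f); rewrite // el ed -?catA.
- move=> G A B _ IH l D r e bD nD.
  have [F [k1 k2 k3 k4]] := IH (Lf A :: l) D r (congr1 (cons (Lf A)) e) bD nD.
  by exists F; split=> //; [exact: cf_ldivR | occ_lia].
- move=> l G r A B C dG IHG dC IHC l0 D r0 e bD nD.
  have bG := cfree_bal dG.
  have block : block_split l (Lf (IRDiv B A) :: G) r l0 D r0 -> interpolable l0 D r0 C.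
    apply: (@interpolable_block [:: Lf B]) => //.
      by move=> x; rewrite !occE; lia.
    by move=> l' r' C' h; exact: cf_rdivL dG h.
  (* The piece contains the division; [block] applies if it contains all
     of [G]. *)
  have base d g : l = l0 ++ d -> D = d ++ Lf (IRDiv B A) :: g -> G ++ r = g ++ r0 ->
      interpolable l0 D r0 C.
    move=> el eD /cat_eq_cat [[M [eG er]]|[f [eg er]]].
      rewrite eG in bG; have [|b1 b2 b3] := @bal_overlap (d ++ [:: Lf (IRDiv B A)]) _ _ _ bG.
        by rewrite -catA -eD.
      rewrite eD er; apply: interpolable_div_rdiv; first by rewrite -eG.
        apply: IHC; rewrite ?el -?catA //; last by case: (d).
        by move: b1; rewrite !bal_Lf.
      by move=> nM; apply: IHG; rewrite // cats0.
    apply: block; apply: (@BlockInside _ _ _ _ _ _ d f) => //.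
    by rewrite eD eg.
  case: (cat_eq_cat e) => [[d [el e1]]|[[|x g] [el e1]]].
  + case: (cat_eq_cat e1) => [[[|x g] [eD e2]]|[f [ed e2]]].
    * by apply: block; apply: (@BlockLeft _ _ _ _ _ _ [::]); rewrite ?eD ?cats0.
    * by case: e2 eD => <- e2 eD; apply: (base d g).
    * by apply: block; apply: (@BlockLeft _ _ _ _ _ _ f); rewrite ?el ?ed.
  + case: D nD bD base block e1 {e} => [|x D] // nD bD base _ [ex e1].
    by apply: (base [::] D); rewrite ?el ?cats0 ?ex.
  + case: e1 el => <- e1 el.
    case: (cat_eq_cat e1) => [[h [eG e2]]|[h [eg er]]].
    * case: (cat_eq_cat e2) => [[f [eD er]]|[f [eh er]]].
      - rewrite eG in bG; rewrite eD in bD; have [b1 b2 b3] := bal_overlap bG bD.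
        rewrite eD el; apply: interpolable_prod_rdiv; rewrite -?eD // -?eG //.
        + by rewrite -er.
        + by move=> nf; apply: IHC; rewrite // er -?catA.
        + by move=> nh; apply: IHG; rewrite // cats0.
      - have [F [k1 k2 k3 k4]] : interpolable g D f A.
          by apply: IHG; rewrite // eG eh -?catA.
        exists F; rewrite el er; split=> //; last by occ_lia.
        by have := cf_rdivL k2 dC; rewrite -?catA.
    * by apply: block; apply: (@BlockRight _ _ _ _ _ _ h); rewrite // el eg -?catA.
- move=> G A B _ IH l D r e bD nD.
  have [|F [k1 k2 k3 k4]] := IH l D (r ++ [:: Lf A]) _ bD nD; first by rewrite e -?catA.
  exists F; split=> //; last by occ_lia.
  by apply: cf_rdivR; rewrite -catA.
- move=> l r A B C _ IH l0 D r0 e bD nD.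
  apply: (@interpolable_block [:: Lf A; Lf B] _ _ _ _ _ _ _ _ _ _ _ _ IH bD nD (split_token e nD)) => //.
    by move=> x; rewrite !occE; lia.
  by move=> l' r' C'; exact: cf_prodL.
- move=> G1 G2 A B d1 IH1 d2 IH2 l D r e bD nD.
  have [b1 b2] := (cfree_bal d1, cfree_bal d2).
  case: (cat_eq_cat e) => [[g [eG e1]]|[g [el e1]]].
  + case: (cat_eq_cat e1) => [[f [eD e2]]|[f [eg er]]].
    * rewrite eG in b1; rewrite eD in bD.
      have [h1 h2 h3] := bal_overlap b1 bD.
      rewrite eD; apply: interpolable_prodR; rewrite -?eG -?e2 -?eD //.
      - by move=> ng; apply: IH1; rewrite // cats0.
      - by move=> nf; apply: IH2.
    * have [F [k1 k2 k3 k4]] : interpolable l D f A by apply: IH1; rewrite // eG eg.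
      exists F; rewrite er; split=> //; last by occ_lia.
      by have := cf_prodR k2 d2; rewrite -?catA.
  + have [F [k1 k2 k3 k4]] : interpolable g D r B by apply: IH2.
    exists F; rewrite el; split=> //; last by occ_lia.
    by have := cf_prodR d1 k2; rewrite -?catA.
- move=> l r k A C _ IH l0 D r0 e bD nD.
  apply: (@interpolable_block [:: Op k; Lf A; Cl k] _ _ _ _ _ _ _ _ _ _ _ _ IH bD nD (split_token e nD)) => //.
  + by rewrite /bal /= eqxx.
  + by move=> x; rewrite !occE; lia.
  + by move=> l' r' C'; exact: cf_diaL.
- move=> k G A dG IH l D r e bD nD; have bG := cfree_bal dG.
  case: (split_bracket bG bD nD e) => [[-> -> ->]|[l' [r' [-> -> eG]]]].
    (* An empty bracket has no other interpolant than the diamond of the unit. *)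
    case: G dG IH bG {e} => [|t G] dG IH bG.
      exists (IDia1 k); split; [exact: cf_dia1R| |by occ_lia|by occ_lia].
      by apply: (@cf_dia1L [::] [::]); exact: (cf_diaR _ dG).
    have [|//|//|F [k1 k2 k3 k4]] := IH [::] (t :: G) [::]; first by rewrite cats0.
    exists (IDia k F); split; [exact: cf_diaR| |by occ_lia|by occ_lia].
    by apply: (@cf_diaL [::] [::]); exact: (cf_diaR _ k2).
  have [F [k1 k2 k3 k4]] := IH _ _ _ eG bD nD.
  exists F; split=> //; last by occ_lia.
  by have := cf_diaR k k2; rewrite -catA.
- move=> l r k C _ IH l0 D r0 e bD nD.
  apply: (@interpolable_block [:: Op k; Cl k] _ _ _ _ _ _ _ _ _ _ _ _ IH bD nD (split_token e nD)) => //.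
  + by rewrite /bal /= eqxx.
  + by move=> l' r' C'; exact: cf_dia1L.
- move=> k l D r e bD nD.
  case: (@split_bracket k [::] l D r isT bD nD e) => [[-> -> ->]|[l' [r' [_ _]]]].
    exists (IDia1 k); split; [exact: cf_dia1R| |by occ_lia|by occ_lia].
    by apply: (@cf_dia1L [::] [::]); exact: cf_dia1R.
  by case: l' => //; case: D nD {bD e}.
- move=> l r k A C dC IH l0 D r0 e bD nD.
  have block : block_split l [:: Op k; Lf (IBox k A); Cl k] r l0 D r0 -> interpolable l0 D r0 C.
    apply: (@interpolable_block [:: Lf A]) => //.
    + by rewrite /bal /= eqxx.
    + by move=> x; rewrite !occE; lia.
    + by move=> l' r' C'; exact: cf_boxL.
  case: (split_token e nD) => [f el er|f er el|d f el er eD].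
  + by apply: block; apply: (@BlockLeft _ _ _ _ _ _ f).
  + case: f er el => [|x f] /=.
      (* The piece is the box alone, without its brackets: here the brackets are
         outside, and the interpolant of the body has to be boxed. *)
      case: D nD bD block e => [|z D] // nD bD block e [ez]; rewrite -ez in bD *.
      case: D bD {nD block e} => [|y D] bD; last by case=> ey; rewrite -ey in bD.
      move=> /= er el; have [|F [k1 k2 k3 k4]] := IH l [:: Lf A] r erefl isT; first by [].
      exists (IBox k F); rewrite el -er.
      split; [|by rewrite -catA; exact: cf_boxL|by occ_lia|by occ_lia].
      by apply: cf_boxR => //; exact: (@cf_boxL [::] [::]) k1.
    case=> <-; case: f => [|y f] /=.
      by case: D nD bD {block e} => [|z D] // _ bD [ez]; rewrite -ez in bD.
    by case=> <- er el; apply: block; apply: (@BlockRight _ _ _ _ _ _ f).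
  + case: f er eD => [|x [|y f]] /=.
    * by move=> _ eD; move: bD; rewrite eD bal_open_end.
    * by case=> <- _ eD; move: bD; rewrite eD -(cat_rcons (Op k)) bal_Lf cats0 -cats1 bal_open_end.
    * by case=> <- <- er eD; apply: block; apply: (@BlockInside _ _ _ _ _ _ d f).
- move=> k G A bG _ IH l D r e bD nD.
  have [|F [k1 k2 k3 k4]] := IH (Op k :: l) D (r ++ [:: Cl k]) _ bD nD.
    by rewrite e -?catA.
  exists F; split=> //; last by occ_lia.
  apply: cf_boxR; last by rewrite -catA.
  by rewrite -(bal_splice l r bD (isT : bal [:: Lf F])) -e.
Qed.

(** * Thin instances *)

Fixpoint ren (f : nat -> nat) (A : itp) : itp :=
  match A with
  | IPrim p => IPrim (f p)
  | ILDiv A B => ILDiv (ren f A) (ren f B)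
  | IRDiv B A => IRDiv (ren f B) (ren f A)
  | IProd A B => IProd (ren f A) (ren f B)
  | IDia k A => IDia (f k) (ren f A)
  | IBox k A => IBox (f k) (ren f A)
  | IDia1 k => IDia1 (f k)
  end.

Definition rent (f : nat -> nat) (t : token) : token :=
  match t with Lf A => Lf (ren f A) | Op k => Op (f k) | Cl k => Cl (f k) end.

Notation rens f := (map (rent f)).

Lemma ren_comp f g h A : f \o g =1 h -> ren f (ren g A) = ren h A.
Proof.
move=> e; elim: A => [p|A IA B IB|B IB A IA|A IA B IB|k A IA|k A IA|k] /=;
  by rewrite ?IA ?IB -?e.
Qed.

Lemma rens_comp f g h s : f \o g =1 h -> rens f (rens g s) = rens h s.
Proof.
move=> e; rewrite -map_comp; apply: eq_map => -[A|k|k] /=; rewrite -?e //.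
by rewrite (ren_comp _ e).
Qed.

Lemma run_ren f st s st' : run st s = Some st' ->
  run (map f st) (rens f s) = Some (map f st').
Proof.
elim: s st => [|[A|k|k] s IH] st /=; [by case=> <- |exact: IH| by move/IH |].
by case: st => [|j st] //=; case: eqP => // -> /IH ->; rewrite eqxx.
Qed.

Lemma bal_ren f s : bal s -> bal (rens f s).
Proof. by move=> /eqP /(run_ren f) h; apply/eqP. Qed.

Lemma cfree_ren f s A : cfree s A -> cfree (rens f s) (ren f A).
Proof.
elim=> {s A} /=.
- by move=> p; exact: cf_ax.
- by move=> l G r A B C _ h1 _; rewrite !map_cat /= => h2; exact: cf_ldivL.
- by move=> G A B _ h; exact: cf_ldivR.
- by move=> l G r A B C _ h1 _; rewrite !map_cat /= map_cat => h2; exact: cf_rdivL.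
- by move=> G A B _; rewrite map_cat => h; exact: cf_rdivR.
- by move=> l r A B C _; rewrite !map_cat; exact: cf_prodL.
- by move=> G D A B _ h1 _ h2; rewrite map_cat; exact: cf_prodR.
- by move=> l r k A C _; rewrite !map_cat; exact: cf_diaL.
- by move=> k G A _ h; rewrite map_cat; exact: cf_diaR.
- by move=> l r k C _; rewrite !map_cat; exact: cf_dia1L.
- by move=> k; exact: cf_dia1R.
- by move=> l r k A C _; rewrite !map_cat; exact: cf_boxL.
- by move=> k G A bG _; rewrite map_cat => h; apply: cf_boxR => //; exact: bal_ren.
Qed.

Definition renl (f : nat -> nat) (x : letter) : letter := (x.1, (x.2.1, f x.2.2)).

Lemma renl_flip f x : renl f (flip x) = flip (renl f x).
Proof. by []. Qed.

Lemma wty_ren f A : wty (ren f A) = map (renl f) (wty A).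
Proof.
have map_inv w : inv (map (renl f) w) = map (renl f) (inv w).
  by rewrite /inv map_rev -!map_comp.
elim: A => [p|A IA B IB|B IB A IA|A IA B IB|k A IA|k A IA|k] //=;
  by rewrite ?map_cat ?IA ?IB ?map_inv.
Qed.

Lemma wd_ren f s : wd (rens f s) = map (renl f) (wd s).
Proof.
elim: s => [|t s IH] //; rewrite /= !wd_cons IH map_cat.
by case: t => //= A; rewrite wty_ren.
Qed.

Lemma renl_inj f : injective f -> injective (renl f).
Proof. by move=> fI [b [c n]] [b' [c' n']] [-> -> /fI ->]. Qed.

Lemma count_renl f x w : injective f ->
  count_mem (renl f x) (map (renl f) w) = count_mem x w.
Proof.
move=> /renl_inj fI; rewrite count_map; apply: eq_count => y /=.
by rewrite (inj_eq fI).
Qed.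

Lemma count_renl_out f x w : (forall n, x.2.2 != f n) ->
  count_mem x (map (renl f) w) = 0.
Proof.
move=> h; rewrite count_map; apply/eqP; rewrite -leqn0 leqNgt -has_count.
apply/hasP => -[y _ /= /eqP e]; move: (h y.2.2); by rewrite -e eqxx.
Qed.

(** The word of a derivable sequent has as many occurrences of a letter as of its
    inverse; bounding both by 1 leaves each link of the derivation its own name. *)
Definition thin (s : seq token) (A : itp) : Prop :=
  forall x, occs x s + occ (flip x) A <= 1.

Lemma thin_uniq s A : thin s A <-> uniq (wd s ++ inv (wty A)).
Proof.
have count_word x : count_mem x (wd s ++ inv (wty A)) = occs x s + occ (flip x) A.
  by rewrite count_cat count_inv.
split=> [h|u x]; last by rewrite -count_word count_uniq_mem // leq_b1.
apply: count_mem_uniq => x; rewrite -has_pred1 has_count.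
by move: (h x); rewrite -count_word; case: (count_mem x _) => [|[|n]].
Qed.

(** Even and odd names keep the letters of two premises apart. *)
Lemma thin_join s1 A1 s2 A2 x : thin s1 A1 -> thin s2 A2 ->
  occs x (rens double s1) + occ (flip x) (ren double A1) +
  (occs x (rens (S \o double) s2) + occ (flip x) (ren (S \o double) A2)) <= 1.
Proof.
move=> h1 h2; rewrite /occs /occ !wd_ren !wty_ren.
have dI : injective double by exact: double_inj.
have sdI : injective (S \o double) by apply: inj_comp => // ? ? [].
have [e|e] : x = renl double (x.1, (x.2.1, x.2.2./2)) \/
             x = renl (S \o double) (x.1, (x.2.1, x.2.2./2)).
- by case: x => b [c n]; have [on|en] := boolP (odd n); [right|left];
    rewrite /renl /= -[in LHS](odd_double_half n) ?on ?(negPf en).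
- set y := (_, _) in e; rewrite e -renl_flip !(count_renl _ _ dI).
  rewrite !count_renl_out; [by rewrite !addn0; exact: (h1 y)| |] => n /=; apply/eqP => /(congr1 odd);
  by rewrite /= !odd_double.
- set y := (_, _) in e; rewrite e -renl_flip !(count_renl _ _ sdI).
  rewrite !count_renl_out; [exact: (h2 y)| |] => n /=; apply/eqP => /(congr1 odd);
  by rewrite /= !odd_double.
Qed.

(** Shifting all names up makes 0 available for the brackets that a rule
    introduces. *)
Lemma thin_fresh s A x : thin s A ->
  occs x (rens S s) + occ (flip x) (ren S A) +
  ((opn 0 == x) + (cls 0 == x) + (opn 0 == flip x) + (cls 0 == flip x)) <= 1.
Proof.
move=> h; rewrite /occs /occ !wd_ren !wty_ren.
case: x => b [c [|n]].
  rewrite !count_renl_out //; by case: b; case: c => [|[|[|c]]].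
have name_neq y : y.2.2 = n.+1 -> (opn 0 == y) = false /\ (cls 0 == y) = false.
  by case: y => ? [? ?] /= ->; split; apply/eqP.
have [-> ->] := name_neq (b, (c, n.+1)) erefl.
have [-> ->] := name_neq (flip (b, (c, n.+1))) erefl.
rewrite !addn0 -[(b, (c, n.+1))]/(renl S (b, (c, n))) -renl_flip.
by rewrite !count_renl; [exact: (h (b, (c, n))) | exact: succn_inj..].
Qed.

Lemma map_eq_cat (T U : Type) (g : T -> U) s a b : map g s = a ++ b ->
  exists a' b', [/\ s = a' ++ b', map g a' = a & map g b' = b].
Proof.
elim: a s => [|x a IH] s /=; first by exists [::], s.
case: s => //= t s [<- /IH [a' [b' [-> <- <-]]]].
by exists (t :: a'), b'.
Qed.

Lemma rens_cons_Lf f s B r : rens f s = Lf B :: r ->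
  exists B' r', [/\ s = Lf B' :: r', ren f B' = B & rens f r' = r].
Proof. by case: s => [|[B'|k|k] r'] //= [<- <-]; exists B', r'. Qed.

Lemma rens_cons_Op f s k r : rens f s = Op k :: r ->
  exists k' r', [/\ s = Op k' :: r', f k' = k & rens f r' = r].
Proof. by case: s => [|[B'|k'|k'] r'] //= [<- <-]; exists k', r'. Qed.

Lemma rens_cons_Cl f s k r : rens f s = Cl k :: r ->
  exists k' r', [/\ s = Cl k' :: r', f k' = k & rens f r' = r].
Proof. by case: s => [|[B'|k'|k'] r'] //= [<- <-]; exists k', r'. Qed.

(** A renaming that merges names could in principle hide a mismatch of
    brackets; it does not when the string inside is balanced already after the
    renaming, since then nothing inside can consume the outer bracket. *)
Lemma bal_ren_bracket f k G j : bal (rens f G) -> bal (Op k :: G ++ [:: Cl j]) ->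
  bal G /\ k = j.
Proof.
have gen st a b c : run (map f a) (rens f G) = Some b -> run (a ++ st) G = Some c ->
    exists b', [/\ b = map f b', c = b' ++ st & run a G = Some b'].
  elim: G a => [|[A|i|i] G IH] a /=.
  - by case=> <- [<-]; exists a.
  - exact: IH.
  - exact: (IH (i :: a)).
  - by case: a => [|i' a] //=; case: eqP => // _; case: eqP => // _; exact: IH.
move=> /eqP bG /eqP /= /run_prefix [c hc hj].
have [b' [eb ec hb]] := gen [:: k] [::] _ _ bG hc.
case: b' eb ec hb => // _ ec hb; split; first by rewrite /bal hb.
by move: hj; rewrite ec /=; case: eqP.
Qed.

Definition join_names (f1 f2 : nat -> nat) (n : nat) : nat :=
  if odd n then f2 n./2 else f1 n./2.

Lemma join_even f1 f2 : join_names f1 f2 \o double =1 f1.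
Proof. by move=> n; rewrite /join_names /= odd_double doubleK. Qed.

Lemma join_odd f1 f2 : join_names f1 f2 \o (S \o double) =1 f2.
Proof. by move=> n; rewrite /join_names /= odd_double /= uphalf_double. Qed.

Definition fresh_name (k : nat) (f : nat -> nat) (n : nat) : nat :=
  if n is n'.+1 then f n' else k.

Lemma fresh_succ k f : fresh_name k f \o S =1 f.
Proof. by []. Qed.

(** An axiom, or a rule that introduces brackets, creates the two occurrences of a
    name at once, and every other rule moves occurrences around; so each link of
    a derivation can be given a name of its own. *)
Theorem thin_instance s A : cfree s A ->
  exists f s' A', [/\ cfree s' A', thin s' A', rens f s' = s & ren f A' = A].
Proof.
elim=> {s A}.
- move=> p; exists (fun=> p), [:: Lf (IPrim 0)], (IPrim 0); split=> //; first exact: cf_ax.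
  by case=> -[] [[|c] [|n]].
- move=> l G r A B C _ [f1 [G' [A' [d1 t1 <- <-]]]] _ [f2 [s' [C' [d2 t2 + <-]]]].
  case/map_eq_cat=> l' [s1 [es <- /rens_cons_Lf [B' [r' [e1 <- <-]]]]]; subst s1.
  exists (join_names f1 f2), (rens (S \o double) l' ++ rens double G' ++
    Lf (ILDiv (ren double A') (ren (S \o double) B')) :: rens (S \o double) r'),
    (ren (S \o double) C'); split.
  + apply: cf_ldivL; first exact: cfree_ren.
    by have := cfree_ren (S \o double) d2; rewrite es map_cat.
  + move=> x; have := thin_join x t1 t2; rewrite es map_cat /= !occE; lia.
  + rewrite !map_cat /= !(rens_comp _ (join_odd _ _)) !(ren_comp _ (join_odd _ _)).
    by rewrite (rens_comp _ (join_even _ _)) (ren_comp _ (join_even _ _)).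
  + by rewrite (ren_comp _ (join_odd _ _)).
- move=> G A B _ [f [s' [B' [d t + <-]]]].
  case/rens_cons_Lf=> A' [G' [es <- <-]].
  exists f, G', (ILDiv A' B'); split=> //; first by apply: cf_ldivR; rewrite -es.
  by move=> x; have := t x; rewrite es !occE; lia.
- move=> l G r A B C _ [f1 [G' [A' [d1 t1 <- <-]]]] _ [f2 [s' [C' [d2 t2 + <-]]]].
  case/map_eq_cat=> l' [s1 [es <- /rens_cons_Lf [B' [r' [e1 <- <-]]]]]; subst s1.
  exists (join_names f1 f2), (rens (S \o double) l' ++
    Lf (IRDiv (ren (S \o double) B') (ren double A')) :: rens double G' ++ rens (S \o double) r'),
    (ren (S \o double) C'); split.
  + apply: cf_rdivL; first exact: cfree_ren.
    by have := cfree_ren (S \o double) d2; rewrite es map_cat.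
  + move=> x; have := thin_join x t1 t2; rewrite es map_cat /= !occE; lia.
  + rewrite !map_cat /= map_cat !(rens_comp _ (join_odd _ _)) !(ren_comp _ (join_odd _ _)).
    by rewrite (rens_comp _ (join_even _ _)) (ren_comp _ (join_even _ _)).
  + by rewrite (ren_comp _ (join_odd _ _)).
- move=> G A B _ [f [s' [B' [d t + <-]]]].
  case/map_eq_cat=> G' [t' [es <- /rens_cons_Lf [A' [[|? ?] [er <- //] _]]]].
  rewrite er in es; exists f, G', (IRDiv B' A'); split=> //.
    by apply: cf_rdivR; rewrite -es.
  by move=> x; have := t x; rewrite es !occE; lia.
- move=> l r A B C _ [f [s' [C' [d t + <-]]]].
  case/map_eq_cat=> l' [s1 [es <- /rens_cons_Lf [A' [s2 [e1 <- /rens_cons_Lf [B' [r' [e2 <- <-]]]]]]]]; subst s1 s2.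
  exists f, (l' ++ Lf (IProd A' B') :: r'), C'; split=> //; last by rewrite map_cat.
    by apply: cf_prodL; rewrite -es.
  by move=> x; have := t x; rewrite es !occE; lia.
- move=> G D A B _ [f1 [G' [A' [d1 t1 <- <-]]]] _ [f2 [D' [B' [d2 t2 <- <-]]]].
  exists (join_names f1 f2), (rens double G' ++ rens (S \o double) D'),
    (IProd (ren double A') (ren (S \o double) B')); split.
  + by apply: cf_prodR; exact: cfree_ren.
  + move=> x; have := thin_join x t1 t2; rewrite !occE; lia.
  + by rewrite map_cat (rens_comp _ (join_odd _ _)) (rens_comp _ (join_even _ _)).
  + by rewrite /= (ren_comp _ (join_odd _ _)) (ren_comp _ (join_even _ _)).
- move=> l r k A C _ [f [s' [C' [d t + <-]]]].
  case/map_eq_cat=> l' [s1 [es <- /rens_cons_Op [k' [s2 [e1 <- /rens_cons_Lf [A' [s3 [e2 <-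
    /rens_cons_Cl [j [r' [e3 ek <-]]]]]]]]]]]; subst s1 s2 s3.
  have ekj : k' = j.
    have := cfree_bal d; rewrite es /bal run_cat; case: (run [::] l') => //= st.
    by case: (k' =P j).
  rewrite -ekj in es; exists f, (l' ++ Lf (IDia k' A') :: r'), C'; split=> //; last by rewrite map_cat.
    by apply: cf_diaL; rewrite -es.
  by move=> x; have := t x; rewrite es !occE; lia.
- move=> k G A _ [f [G' [A' [d t <- <-]]]].
  exists (fresh_name k f), (Op 0 :: rens S G' ++ [:: Cl 0]), (IDia 0 (ren S A')); split.
  + by apply: cf_diaR; exact: cfree_ren.
  + by move=> x; have := thin_fresh x t; rewrite !occE; lia.
  + by rewrite /= map_cat (rens_comp _ (fresh_succ _ _)).
  + by rewrite /= (ren_comp _ (fresh_succ _ _)).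
- move=> l r k C _ [f [s' [C' [d t + <-]]]].
  case/map_eq_cat=> l' [s1 [es <- /rens_cons_Op [k' [s2 [e1 <- /rens_cons_Cl [j [r' [e2 ek <-]]]]]]]]; subst s1 s2.
  have ekj : k' = j.
    have := cfree_bal d; rewrite es /bal run_cat; case: (run [::] l') => //= st.
    by case: (k' =P j).
  rewrite -ekj in es; exists f, (l' ++ Lf (IDia1 k') :: r'), C'; split=> //; last by rewrite map_cat.
    by apply: cf_dia1L; rewrite -es.
  by move=> x; have := t x; rewrite es !occE; lia.
- move=> k; exists (fun=> k), [:: Op 0; Cl 0], (IDia1 0); split=> //; first exact: cf_dia1R.
  by case=> -[] [[|[|[|c]]] [|n]].
- move=> l r k A C _ [f [s' [C' [d t + <-]]]].
  case/map_eq_cat=> l' [s1 [es <- /rens_cons_Lf [A' [r' [e1 <- <-]]]]]; subst s1.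
  exists (fresh_name k f), (rens S l' ++ [:: Op 0, Lf (IBox 0 (ren S A')), Cl 0 & rens S r']), (ren S C'); split.
  + by apply: cf_boxL; have := cfree_ren S d; rewrite es map_cat.
  + by move=> x; have := thin_fresh x t; rewrite es map_cat /= !occE; lia.
  + by rewrite map_cat /= !(rens_comp _ (fresh_succ _ _)) (ren_comp _ (fresh_succ _ _)).
  + by rewrite (ren_comp _ (fresh_succ _ _)).
- move=> k G A bG _ [f [s' [A' [d t + <-]]]].
  case/rens_cons_Op=> k' [s1 [es <- /map_eq_cat [G' [s2 [e1 eG /rens_cons_Cl [j [s3 [e2 ek e3]]]]]]]].
  case: s3 e2 e3 => // e2 _; subst s1 s2.
  rewrite -eG in bG; have [bG' ekj] : bal G' /\ k' = j.
    by apply: (bal_ren_bracket bG); rewrite -es; exact: cfree_bal d.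
  rewrite -ekj in es; exists f, G', (IBox k' A'); split=> //.
  + by apply: cf_boxR => //; rewrite -es.
  + by move=> x; have := t x; rewrite es !occE; lia.
Qed.

(** * Crossings in noncrossing words *)

Lemma uniq_cat_disjoint (T : eqType) (a b : seq T) x :
  uniq (a ++ b) -> x \in a -> x \in b -> False.
Proof. by rewrite cat_uniq => /and3P[_ /hasPn h _] xa /h; rewrite /= xa. Qed.

(** For a segment [X] of a thin word that reduces to the empty word, this is the
    length of [X] after reduction, that is, the distance between the ends of a path
    labelled by [X] in the Cayley graph of the free group, which is a tree. *)
Definition crossing (X : seq letter) : nat := count (fun x => flip x \notin X) X.

Definition links (X Y : seq letter) : nat := count (fun x => flip x \in Y) X.

Definition mated (W : seq letter) : Prop := forall x, x \in W -> flip x \in W.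

Lemma crossing_links X Y : uniq (X ++ Y) -> mated (X ++ Y) -> crossing X = links X Y.
Proof.
rewrite cat_uniq => /and3P[_ /hasPn dXY _] mW; apply: eq_in_count => x xX.
have := mW x; rewrite !mem_cat xX => /(_ isT).
by case: (boolP (flip x \in Y)) => [/dXY /= /negPf ->|_]; rewrite ?orbF => // ->.
Qed.

Lemma links_catl X1 X2 Y : links (X1 ++ X2) Y = links X1 Y + links X2 Y.
Proof. exact: count_cat. Qed.

Lemma links_catr X Y1 Y2 : uniq (Y1 ++ Y2) -> links X (Y1 ++ Y2) = links X Y1 + links X Y2.
Proof.
rewrite cat_uniq => /and3P[_ /hasPn dY _]; rewrite /links -count_predUI.
rewrite [X in _ = _ + X](_ : _ = 0) ?addn0.
  by apply: eq_count => x /=; rewrite mem_cat.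
apply/eqP; rewrite -leqn0 leqNgt -has_count; apply/hasP => -[x _ /= /andP[h1 /dY]].
by rewrite /= h1.
Qed.

Lemma links_sym X Y : uniq X -> uniq Y -> links X Y = links Y X.
Proof.
move=> uX uY; rewrite /links -!size_filter -(size_map flip [seq _ <- X | _]).
apply/perm_size/uniq_perm; rewrite ?filter_uniq //.
  by rewrite map_inj_uniq ?filter_uniq //; exact: inv_inj flipK.
move=> y; rewrite -[y in LHS]flipK mem_map; last exact: inv_inj flipK.
by rewrite !mem_filter flipK andbC.
Qed.

Lemma links0 X Y : links X Y = 0 \/ exists2 x, x \in X & flip x \in Y.
Proof.
case: (posnP (links X Y)) => [->|]; first by left.
by rewrite -has_count => /hasP [x]; right; exists x.
Qed.

Lemma red_mated W : red W -> mated W.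
Proof. by move=> rW x; exact: red_mate. Qed.

(** The four-point condition of trees.  The hypotheses say that the end of
    [P ++ Q] is at least as far from the root as its neighbours along [Q] and [R].
    In terms of links between the four segments, they read
    [PQ <= QR + QT] and [RT <= PR + QR], and [PR] or [QT] is 0. *)
Lemma four_point P Q R T :
  red (P ++ Q ++ R ++ T) -> uniq (P ++ Q ++ R ++ T) ->
  crossing P <= crossing (P ++ Q) -> crossing (P ++ Q ++ R) <= crossing (P ++ Q) ->
  crossing (Q ++ R) <= maxn (crossing Q) (crossing R).
Proof.
move=> rW uW.
have mW := red_mated rW.
have cr X Y : perm_eq (P ++ Q ++ R ++ T) (X ++ Y) -> crossing X = links X Y.
  move=> e; apply: crossing_links; first by rewrite -(perm_uniq e).
  by move=> x; rewrite -!(perm_mem e); exact: mW.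
have sub X : subseq X (P ++ Q ++ R ++ T) -> uniq X by move/subseq_uniq; apply.
have [uP uQ uR uT] : [/\ uniq P, uniq Q, uniq R & uniq T].
  by move: uW; rewrite !cat_uniq => /and3P[-> _ /and3P[-> _ /and3P[-> _ ->]]].
have uQRT : uniq (Q ++ R ++ T) by move: uW; rewrite cat_uniq => /and3P[].
have uRT : uniq (R ++ T) by move: uQRT; rewrite cat_uniq => /and3P[].
have uPT : uniq (P ++ T).
  by apply: sub; rewrite cat_subseq // catA suffix_subseq.
have uPRT : uniq (P ++ R ++ T).
  by apply: sub; rewrite cat_subseq // suffix_subseq.
have uPQT : uniq (P ++ Q ++ T).
  by apply: sub; rewrite !cat_subseq // suffix_subseq.
have uQT : uniq (Q ++ T) by move: uPQT; rewrite cat_uniq => /and3P[].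
have noncross : links P R = 0 \/ links Q T = 0.
  have [|[x xP xR]] := links0 P R; first by left.
  have [|[y yQ yT]] := links0 Q T; first by right.
  exfalso; case/splitPr: xP rW uW => P1 P2; case/splitPr: xR => R1 R2 rW uW.
  have := @red_noncrossing _ rW uW P1 x (P2 ++ Q ++ R1) (R2 ++ T).
  rewrite -?catA /= -?catA => /(_ erefl y); rewrite !mem_cat yQ orbT => /(_ isT) yV.
  apply: (@uniq_cat_disjoint _ (P1 ++ x :: P2 ++ Q ++ R1 ++ flip x :: R2) T (flip y)) => //.
    by move: uW; rewrite -?catA /= -?catA.
  by rewrite !(mem_cat, inE); case/or3P: yV => ->; rewrite ?orbT.
rewrite (cr P (Q ++ R ++ T)) // (cr (P ++ Q) (R ++ T)); last by rewrite -catA.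
rewrite (cr (P ++ Q ++ R) T); last by rewrite -!catA.
rewrite (cr (Q ++ R) (P ++ T)); last by rewrite -?catA perm_catCA perm_cat2l perm_catCA.
rewrite (cr Q (P ++ R ++ T)); last by rewrite perm_catCA.
rewrite (cr R (P ++ Q ++ T)); last first.
  by rewrite perm_sym perm_catCA perm_cat2l perm_catCA.
rewrite !links_catl !links_catr //.
rewrite (links_sym uQ uP) (links_sym uR uP) (links_sym uR uQ).
by clear -noncross; lia.
Qed.

Lemma crossing_leq X K : uniq X ->
  (forall y, y \in X -> flip y \notin X -> y \in K) -> crossing X <= size K.
Proof.
move=> uX h; rewrite /crossing -size_filter; apply: uniq_leq_size; first exact: filter_uniq.
by move=> y; rewrite mem_filter => /andP[n1 n2]; exact: h.
Qed.

Lemma crossing_leq_mate X K : uniq X ->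
  (forall y, y \in X -> flip y \notin X -> flip y \in K) -> crossing X <= size K.
Proof.
move=> uX h; rewrite -(size_map flip K); apply: crossing_leq => // y yX fy.
by rewrite -[y]flipK mem_map ?h //; exact: inv_inj flipK.
Qed.

(** * Short pieces of thin sequents *)

(** A letter of the interpolant is found in [D], while its inverse is found
    outside and hence, by thinness, not in [D]. *)
Lemma interpolant_thin l D r C B :
  thin (l ++ D ++ r) C -> interpolant l D r C B ->
  [/\ thin D B, thin (l ++ Lf B :: r) C, {subset wty B <= wd D}
    & size (wty B) <= crossing (wd D)].
Proof.
move=> t [_ _ h1 h2].
have occ_gt0 x A : (0 < occ x A) = (x \in wty A) by rewrite /occ -has_count has_pred1.
have occs_gt0 x s : (0 < occs x s) = (x \in wd s) by rewrite /occs -has_count has_pred1.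
have sub : {subset wty B <= wd D}.
  by move=> x; rewrite -occ_gt0 -occs_gt0; have := h1 x; lia.
split=> //.
- by move=> x; move: (t x) (h2 (flip x)); rewrite !occE; lia.
- by move=> x; move: (t x) (h1 x); rewrite !occE; lia.
- rewrite /crossing -size_filter; apply: uniq_leq_size.
    apply: count_mem_uniq => x; rewrite -occ_gt0 -/(occ x B).
    by move: (t x) (h1 x); rewrite !occE; case: (occ x B) => [|[|n]] //; lia.
  move=> x xB; rewrite mem_filter sub // andbT -occs_gt0.
  move: xB; rewrite -occ_gt0; move: (t (flip x)) (h2 x); rewrite !occE; lia.
Qed.

(** This is why the mates of both ends of a bracket are found in the same type. *)
Lemma wty_pair k A :
  (opn k \in wty A) = (cls k \in wty A) /\
  (flip (opn k) \in wty A) = (flip (cls k) \in wty A).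
Proof.
have e1 j : (opn k == opn j) = (cls k == cls j) by [].
have e2 j : (opn k == cls j) = false by [].
have e3 j : (cls k == opn j) = false by [].
have e4 x y : (flip x == flip y) = (x == y) by rewrite flip_eq flipK.
pose e := (e1, e2, e3, e4).
elim: A => [p|A [A1 A2] B [B1 B2]|B [B1 B2] A [A1 A2]|A [A1 A2] B [B1 B2]
  |j A [A1 A2]|j A [A1 A2]|j]; rewrite /= ?(mem_cat, inE, mem_inv, flipK) ?A1 ?A2 ?B1 ?B2 //.
- by rewrite !e !orbF; split=> //; rewrite orbC.
- by rewrite !e !orbF; split=> //; rewrite orbC.
- by rewrite !e !orbF.
Qed.

(** Brackets contribute positive letters only, so the mate of a bracket is never
    another bracket but a modality inside some type. *)
Lemma wd_flip_opn k s : flip (opn k) \in wd s ->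
  exists s1 C s2, [/\ s = s1 ++ Lf C :: s2, flip (opn k) \in wty C & flip (cls k) \in wty C].
Proof.
elim: s => [|t s IH] //; rewrite wd_cons mem_cat => /orP[|/IH [s1 [C [s2 [-> h1 h2]]]]].
  case: t => [C h|j|j] //; exists [::], C, s; split=> //.
  by rewrite -(wty_pair k C).2.
by exists (t :: s1), C, s2.
Qed.

Lemma mem_split2 (T : eqType) (x : T) s : x \in s -> exists s1 s2, s = s1 ++ x :: s2.
Proof. by case/splitPr => s1 s2; exists s1, s2. Qed.

Lemma uniq_catl (T : eqType) (a b : seq T) : uniq (a ++ b) -> uniq a.
Proof. by rewrite cat_uniq => /and3P[]. Qed.

(** The bracket around [D] is matched by a modality in a type of [D] with word [K].
    The stretches between the bracket and [K], on either side, are closed under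
    links; all crossings start in [K]. *)
Lemma crossing_inside k U1 K U2 Z (D := U1 ++ K ++ U2) (W := opn k :: D ++ cls k :: Z) :
  red W -> uniq W -> flip (opn k) \in K -> flip (cls k) \in K ->
  crossing D <= size K /\ crossing (opn k :: D ++ [:: cls k]) <= size K.
Proof.
move=> rW uW oK cK.
have [K1 [K2 eK]] := mem_split2 oK; have [K1' [K2' eK']] := mem_split2 cK.
have V1 y : y \in U1 -> flip y \in D.
  move=> yU; have := @red_noncrossing _ rW uW [::] (opn k) (U1 ++ K1) (K2 ++ U2 ++ cls k :: Z).
  rewrite /W /D eK -?catA /= -?catA => /(_ erefl y); rewrite !mem_cat yU => /(_ isT).
  by case/orP=> ->; rewrite ?orbT.
have V2 y : y \in U2 -> flip y \in D.
  move=> yU; have := @red_noncrossing _ rW uW (opn k :: U1 ++ K1') (flip (cls k)) (K2' ++ U2) Z.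
  rewrite flipK /W /D eK' /= -?catA /= -?catA => /(_ erefl y); rewrite !mem_cat yU orbT => /(_ isT).
  by rewrite !(mem_cat, inE); case/orP=> ->; rewrite ?orbT.
have uD : uniq (opn k :: D ++ [:: cls k]).
  by apply: (@uniq_catl _ _ Z); rewrite /= -catA.
have inner y : y \in D -> flip y \notin D -> y \in K.
  by rewrite !mem_cat => /or3P[/V1 h|->//|/V2 h]; rewrite -!mem_cat ?h.
have oD : flip (opn k) \in D by rewrite !mem_cat oK orbT.
have cD : flip (cls k) \in D by rewrite !mem_cat cK orbT.
split.
  by apply: crossing_leq inner; move: uD; rewrite /= cat_uniq => /and3P[].
apply: crossing_leq => // y; rewrite !(inE, mem_cat) -!mem_cat.
case/or3P=> [/eqP ->|yD|/eqP ->]; rewrite ?oD ?cD ?orbT // negb_or => /andP[_].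
by rewrite negb_or => /andP[h _]; exact: inner.
Qed.

(** The bracket is matched in a word [K] to the right of it.  The link of the
    closing bracket encloses [Z1] and part of [K], and the link of the opening
    bracket goes around it; what leaves [D] is caught between the two and ends in
    [K]. *)
Lemma crossing_outside k D Z1 K Z2 (W := opn k :: D ++ cls k :: Z1 ++ K ++ Z2) :
  red W -> uniq W -> flip (opn k) \in K -> flip (cls k) \in K ->
  crossing D <= size K /\ crossing (opn k :: D ++ [:: cls k]) <= size K.
Proof.
move=> rW uW oK cK.
have [K1 [K2 eK]] := mem_split2 oK; have [K1' [K2' eK']] := mem_split2 cK.
have disjD y : y \in D -> y \in Z1 ++ K -> False.
  move=> yD yZ; apply: (@uniq_cat_disjoint _ D (cls k :: Z1 ++ K ++ Z2) y) => //.
    by move: uW => /andP[].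
  by rewrite inE catA mem_cat yZ orbT.
have inner y : y \in D -> flip y \notin D -> flip y \in K.
  move=> yD yD'; have := @red_noncrossing _ rW uW [::] (opn k) (D ++ cls k :: Z1 ++ K1) (K2 ++ Z2).
  rewrite /W eK -?catA /= -?catA => /(_ erefl y); rewrite !(mem_cat, inE) yD (negPf yD') => /(_ isT) /=.
  case/or3P=> [/eqP ey|yZ|->] //.
    by case: (disjD y yD); rewrite -[y]flipK ey mem_cat cK orbT.
  case: (disjD y yD); have := @red_noncrossing _ rW uW (opn k :: D) (cls k) (Z1 ++ K1') (K2' ++ Z2).
  rewrite /W eK' /= -?catA /= -?catA => /(_ erefl (flip y)); rewrite flipK !mem_cat yZ => /(_ isT).
  by rewrite !(mem_cat, inE); case/orP=> ->; rewrite ?orbT.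
have uD : uniq (opn k :: D ++ [:: cls k]).
  by apply: (@uniq_catl _ _ (Z1 ++ K ++ Z2)); rewrite /= -catA.
split.
  by apply: crossing_leq_mate inner; move: uD; rewrite /= cat_uniq => /and3P[].
apply: crossing_leq_mate => // y; rewrite !(inE, mem_cat).
case/or3P=> [/eqP ->|yD|/eqP ->] //; rewrite negb_or => /andP[_].
by rewrite negb_or => /andP[h _]; exact: inner.
Qed.

Fixpoint leaves (s : seq token) : seq itp :=
  match s with
  | [::] => [::]
  | Lf A :: s' => A :: leaves s'
  | _ :: s' => leaves s'
  end.

Lemma leaves_cat s t : leaves (s ++ t) = leaves s ++ leaves t.
Proof. by elim: s => [|[A|k|k] s IH] //=; rewrite IH. Qed.

Definition small (m : nat) (s : seq token) : bool :=
  all (fun A => size (wty A) <= m) (leaves s).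

Lemma small_leaf m s l C r : small m s -> s = l ++ Lf C :: r -> size (wty C) <= m.
Proof. by move=> + e; rewrite /small e leaves_cat all_cat => /and3P[]. Qed.

(** The word of the sequent may be read cyclically, so that a type to the left
    of the bracket, or the succedent, can be moved to its right. *)
Lemma bracket_short m l k D r A (s := l ++ Op k :: D ++ Cl k :: r) :
  cfree s A -> thin s A -> small m s -> size (wty A) <= m ->
  crossing (wd D) <= m /\ crossing (wd (Op k :: D ++ [:: Cl k])) <= m.
Proof.
move=> /cfree_red rs /thin_uniq us hs hA.
have e : wd s ++ inv (wty A) = wd l ++ (opn k :: wd D ++ cls k :: wd r ++ inv (wty A)).
  by rewrite /s wd_cat wd_cons wd_cat wd_cons -!catA.
have rW : red (opn k :: wd D ++ cls k :: wd r ++ inv (wty A) ++ wd l).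
  by move: rs; rewrite e => /red_rot; rewrite /= -?catA /= -?catA.
have uW : uniq (opn k :: wd D ++ cls k :: wd r ++ inv (wty A) ++ wd l).
  by move: us; rewrite e uniq_catC /= -?catA /= -?catA.
have -> : wd (Op k :: D ++ [:: Cl k]) = opn k :: wd D ++ [:: cls k].
  by rewrite wd_cons wd_cat wd1.
have trans X Y n : crossing X <= n /\ crossing Y <= n -> n <= m ->
    crossing X <= m /\ crossing Y <= m.
  by move=> [h1 h2] nm; split; [exact: leq_trans h1 nm | exact: leq_trans h2 nm].
have : flip (opn k) \in opn k :: wd D ++ cls k :: wd r ++ inv (wty A) ++ wd l.
  by apply: red_mate => //; rewrite inE eqxx.
rewrite inE flip_neq mem_cat inE !mem_cat /= => /or4P[].
- move=> /wd_flip_opn [s1 [C [s2 [eD oC cC]]]].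
  apply: (trans _ _ (size (wty C))); last first.
    by apply: (small_leaf (l := l ++ Op k :: s1) (r := s2 ++ Cl k :: r) hs); rewrite /s eD -?catA.
  move: rW uW; rewrite eD wd_cat wd_cons => rW uW.
  exact: crossing_inside rW uW oC cC.
- move=> /wd_flip_opn [s1 [C [s2 [er oC cC]]]].
  apply: (trans _ _ (size (wty C))); last first.
    by apply: (small_leaf (l := l ++ Op k :: D ++ Cl k :: s1) (r := s2) hs); rewrite /s er -?catA /= -?catA.
  move: rW uW; rewrite er wd_cat wd_cons -?catA => rW uW.
  exact: crossing_outside rW uW oC cC.
- move=> oA; apply: (trans _ _ (size (inv (wty A)))); last by rewrite size_inv.
  apply: (crossing_outside rW uW oA); move: oA; rewrite !mem_inv !flipK.
  by rewrite (wty_pair k A).1.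
- move=> /wd_flip_opn [s1 [C [s2 [el oC cC]]]].
  apply: (trans _ _ (size (wty C))); last first.
    by apply: (small_leaf (l := s1) (r := s2 ++ Op k :: D ++ Cl k :: r) hs); rewrite /s el -?catA.
  move: rW uW; rewrite el wd_cat wd_cons => rW uW.
  by apply: (@crossing_outside k (wd D) (wd r ++ inv (wty A) ++ wd s1) _ (wd s2));
    rewrite -?catA.
Qed.

(** If the stack ends up no higher than [st], the bracket [k] on top of [st] has
    been closed. *)
Lemma run_open_split k st st' s : run (k :: st) s = Some st' -> size st' <= size st ->
  exists D r, [/\ s = D ++ Cl k :: r, bal D & run st r = Some st'].
Proof.
elim: {s}(size s) {-2}s (leqnn (size s)) k st => [|n IH] [|[A|j|j] s] //= hn k st.
- by case=> <-; rewrite ltnn.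
- by case=> <-; rewrite ltnn.
- by move=> /(IH s hn) h /h [D [r [-> bD hr]]]; exists (Lf A :: D), r.
- move=> h hs; have [D1 [r1 [e1 b1 h1]]] := IH s hn _ _ h (leq_trans hs (leqnSn _)).
  have [|D2 [r2 [e2 b2 h2]]] := IH r1 _ _ _ h1 hs.
    by move: hn; rewrite e1 size_cat /=; lia.
  exists (Op j :: D1 ++ Cl j :: D2), r2; split=> //; first by rewrite e1 e2 /= -catA.
  by rewrite /bal /= run_bal_cat //= eqxx.
- by case: eqP => // <- h _; exists [::], s.
Qed.

Lemma bal_open_split l k s : bal (l ++ Op k :: s) ->
  exists D r, s = D ++ Cl k :: r /\ bal D.
Proof.
move=> /eqP /run_prefix [st _ /= /run_open_split] [] // D [r [-> bD _]].
by exists D, r.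
Qed.

Lemma bal_leaves s : bal s -> (exists l k r, s = l ++ Op k :: r) \/ s = map Lf (leaves s).
Proof.
rewrite /bal; elim: s => [|[A|k|k] s IH] //=; first by right.
  case/IH=> [[l [k [r ->]]]|es]; last by right; rewrite -es.
  by left; exists (Lf A :: l), k, r.
by left; exists [::], k, s.
Qed.

Lemma nat_argmax (h : nat -> nat) n :
  exists k, k <= n /\ forall j, j <= n -> h j <= h k.
Proof.
elim: n => [|n [k [kn hk]]]; first by exists 0; split=> // j; rewrite leqn0 => /eqP ->.
have [le|lt] := leqP (h n.+1) (h k).
  exists k; split=> [|j]; first exact: leqW.
  by rewrite leq_eqVlt => /orP[/eqP ->|/hk].
exists n.+1; split=> // j; rewrite leq_eqVlt => /orP[/eqP -> //|/hk hj].
exact: leq_trans hj (ltnW lt).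
Qed.

Lemma flat_short m ts A (s := map Lf ts) : cfree s A -> thin s A ->
  (forall C, C \in ts -> size (wty C) <= m) -> size (wty A) <= m -> 2 < size ts ->
  exists l D r, [/\ s = l ++ D ++ r, bal D, 1 < size D < size s & crossing (wd D) <= m].
Proof.
move=> /cfree_red rs /thin_uniq us hs hA n2.
have bal_s us' : bal (map Lf us') by elim: us'.
(* The distance from the root after [j] types. *)
pose h j := crossing (wd (map Lf (take j ts))).
have hn : h (size ts) <= m.
  rewrite /h take_size; apply: leq_trans hA; rewrite -size_inv; apply: crossing_leq_mate.
    by move: us; rewrite cat_uniq => /andP[].
  move=> y yS fy; have := red_mate rs (x := y); rewrite !mem_cat yS => /(_ isT).
  by rewrite (negPf fy).
have [le|lt] := leqP (h (size ts).-1) (h (size ts)).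
  exists [::], (map Lf (take (size ts).-1 ts)), (map Lf (drop (size ts).-1 ts)).
  split=> //; [by rewrite /= -map_cat cat_take_drop | | exact: leq_trans le hn].
  by rewrite !size_map size_take; case: ifP; lia.
(* The distance decreases at the last type, so it is largest at an inner point. *)
have [k [kn hk]] := nat_argmax h (size ts).
have k_lt : k < size ts.
  rewrite ltn_neqAle kn andbT; apply: contraTneq lt => <-.
  by rewrite -leqNgt hk // (leq_trans (leq_pred _)).
have k_gt : 0 < k.
  rewrite lt0n; apply: contraTneq lt => k0; rewrite -leqNgt.
  by apply: leq_trans (hk _ (leq_pred _)) _; rewrite k0 /h take0.
case: k k_gt hk kn k_lt => // k _ hk _ k_lt.
have [A0 _] : exists A0 : itp, True by case: (ts) n2 => // A0; exists A0.
pose B := nth A0 ts k; pose C := nth A0 ts k.+1.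
have e1 : take k.+1 ts = rcons (take k ts) B by rewrite (take_nth A0) // ltnW.
have e2 : take k.+2 ts = rcons (rcons (take k ts) B) C by rewrite (take_nth A0) // e1.
have ets : ts = take k ts ++ B :: C :: drop k.+2 ts.
  by rewrite -{1}(cat_take_drop k.+2 ts) e2 -!cats1 -!catA.
exists (map Lf (take k ts)), [:: Lf B; Lf C], (map Lf (drop k.+2 ts)); split=> //.
- by rewrite {1}/s {1}ets map_cat.
- by rewrite size_map.
- have -> : wd [:: Lf B; Lf C] = wty B ++ wty C by rewrite wd_cons wd1.
  have eW : wd s ++ inv (wty A) =
      wd (map Lf (take k ts)) ++ wty B ++ wty C ++ (wd (map Lf (drop k.+2 ts)) ++ inv (wty A)).
    by rewrite {1}/s {1}ets map_cat wd_cat /= !wd_cons -!catA.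
  move: (hk k) (hk k.+2); rewrite /h e1 e2 !map_rcons -!cats1 -catA !wd_cat !wd1.
  move=> /(_ (ltnW (ltnW k_lt))) h1 /(_ k_lt) h2.
  rewrite eW in rs us; apply: leq_trans (four_point rs us h1 h2) _.
  have size_le D : D \in ts -> crossing (wty D) <= m.
    by move=> /hs; apply: leq_trans; exact: count_size.
  by rewrite geq_max !size_le // mem_nth // ltnW.
Qed.

(** Three leaves ensure that the piece found has at least two tokens without
    being the whole antecedent, so that both the piece and what remains after
    replacing it by one type are smaller. *)
Theorem short_piece m s A : cfree s A -> thin s A -> small m s -> size (wty A) <= m ->
  2 < size (leaves s) ->
  exists l D r, [/\ s = l ++ D ++ r, bal D, 1 < size D < size s & crossing (wd D) <= m].
Proof.
move=> d t hs hA n2; case: (bal_leaves (cfree_bal d)) => [[l [k [s' es]]]|es].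
  have [D [r [es' bD]]] := @bal_open_split l k s' ltac:(by rewrite -es; exact: cfree_bal d).
  rewrite {}es' in es; rewrite es in d t hs.
  have [h1 h2] := bracket_short d t hs hA.
  have [lr0|lr] := posnP (size l + size r).
    exists (l ++ [:: Op k]), D, (Cl k :: r); split=> //; first by rewrite es -?catA.
    move: lr0 n2; rewrite es; case: (l) => //; case: (r) => // _.
    have : size (leaves D) <= size D by elim: (D) => [|[?|?|?] D' IH] //=; exact: leqW.
    by rewrite /= leaves_cat !size_cat /=; lia.
  exists l, (Op k :: D ++ [:: Cl k]), r; split=> //; first by rewrite es /= -?catA.
    exact: bal_bracket.
  by rewrite es /= !size_cat /= !size_cat /=; lia.
have n2' := n2; move: d t hs; rewrite es => d t hs.
have [|l [D [r [h1 h2 h3 h4]]]] := flat_short d t _ hA n2'; last by exists l, D, r.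
move=> C /mem_split2 [s1 [s2 e]]; apply: (small_leaf (l := map Lf s1) (r := map Lf s2) hs).
by rewrite e map_cat.
Qed.

(** * The grammar *)

Definition named (N : nat) (x : letter) : bool := x.2.2 < N.

Lemma wty_size_gt0 A : 0 < size (wty A).
Proof. by elim: A => //= *; rewrite size_cat ?size_inv; lia. Qed.

(** No type has an empty word, so the length bounds the number of connectives;
    with the unit among the types this would fail. *)
Lemma short_types m N : exists T : seq itp, forall A,
  size (wty A) <= m -> all (named N) (wty A) -> A \in T.
Proof.
have all_inv w : all (named N) (inv w) = all (named N) w.
  by rewrite /inv all_rev all_map.
elim: m => [|m [T hT]]; first by exists [::] => A; rewrite leqNgt wty_size_gt0.
pose names := iota 0 N.
exists ([seq IPrim p | p <- names] ++ [seq IDia1 p | p <- names] ++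
  [seq IDia k A | k <- names, A <- T] ++ [seq IBox k A | k <- names, A <- T] ++
  [seq ILDiv A B | A <- T, B <- T] ++ [seq IRDiv B A | B <- T, A <- T] ++
  [seq IProd A B | A <- T, B <- T]).
have inn n : n < N -> n \in names by rewrite mem_iota.
case=> [p|A B|B A|A B|k A|k A|k]; rewrite !mem_cat /=.
- by rewrite andbT => _ hp; rewrite map_f ?inn.
- rewrite size_cat size_inv all_cat all_inv => hs /andP[nA nB].
  have := (wty_size_gt0 A, wty_size_gt0 B) => -[hA hB].
  by rewrite (allpairs_f ILDiv) ?orbT //; apply: hT => //; lia.
- rewrite size_cat size_inv all_cat all_inv => hs /andP[nB nA].
  have := (wty_size_gt0 A, wty_size_gt0 B) => -[hA hB].
  by rewrite (allpairs_f IRDiv) ?orbT //; apply: hT => //; lia.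
- rewrite size_cat all_cat => hs /andP[nA nB].
  have := (wty_size_gt0 A, wty_size_gt0 B) => -[hA hB].
  by rewrite (allpairs_f IProd) ?orbT //; apply: hT => //; lia.
- rewrite size_cat all_cat /= => hs /and3P[nk nA _].
  by rewrite (allpairs_f IDia) ?orbT ?inn //; apply: hT => //; lia.
- rewrite size_cat all_cat /= => hs /and3P[nk nA _].
  by rewrite (allpairs_f IBox) ?orbT ?inn //; apply: hT => //; lia.
- by move=> _ /andP[nk _]; rewrite (map_f IDia1) ?inn ?orbT.
Qed.

(** Excluded middle stands in for a decision procedure for derivability when the
    productions are selected. *)
Lemma seq_comprehension (T : eqType) (P : T -> Prop) (s : seq T) :
  exists t : seq T, forall x, x \in t <-> x \in s /\ P x.
Proof.
elim: s => [|y s [t ht]]; first by exists [::] => x; split=> [|[]].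
have [Py|nPy] := classic (P y).
- exists (y :: t) => x; rewrite !inE; split.
  + by case/predU1P=> [->|/ht [xs Px]]; rewrite ?eqxx ?xs ?orbT.
  + by case=> /predU1P [->|xs] Px; rewrite ?eqxx //; apply/orP; right; apply/ht.
- exists t => x; rewrite inE ht; split=> [[-> Px]|[/predU1P [->|xs] Px]];
    by rewrite ?orbT.
Qed.

(** Only the index 0 comes from brackets of the original calculus. *)
Definition plain (s : seq token) : bool :=
  all (fun t => if t is Op k then k == 0 else if t is Cl k then k == 0 else true) s.

(** A terminal denotes all types that the lexicon gives it, so lexical lookup
    needs no productions of its own. *)
Definition denotes (Sigma : finType) (I : Type) (ty : I -> itp) (lex : seq (Sigma * tp))
    (a : I + Sigma) (A : itp) : Prop :=
  match a with
  | inl X => ty X = A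
  | inr c => exists2 B, (c, B) \in lex & A = emb B
  end.

Notation denote ty lex := (List.Forall2 (denotes ty lex)).

Definition sound_production (Sigma : finType) (I : Type) (ty : I -> itp)
    (lex : seq (Sigma * tp)) (p : I * seq (I + Sigma)) : Prop :=
  exists s, [/\ cfree s (ty p.1), plain s & denote ty lex p.2 (leaves s)].

Lemma exists_grammar (Sigma : finType) (I : finType) (ty : I -> itp)
    (lex : seq (Sigma * tp)) :
  exists prods : seq (I * seq (I + Sigma)), forall p,
    p \in prods <-> size p.2 <= 2 /\ sound_production ty lex p.
Proof.
pose E := enum {: I + Sigma}.
pose words := [::] :: [seq [:: a] | a <- E] ++ [seq [:: a; b] | a <- E, b <- E].
have words2 w : (w \in words) = (size w <= 2).
  apply/idP/idP.
    rewrite inE mem_cat => /or3P[/eqP -> //|/mapP [a _ ->] //|].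
    by case/allpairsP => -[a b] [_ _ ->].
  rewrite inE mem_cat; case: w => [|a [|b [|c w]]] // _.
  - by rewrite map_f ?mem_enum.
  - by rewrite (allpairs_f (fun a b => [:: a; b])) ?mem_enum ?orbT.
have [prods hp] := seq_comprehension (sound_production ty lex)
  [seq (X, w) | X <- enum I, w <- words].
exists prods => -[X w]; rewrite hp; split=> -[h1 h2]; split=> //.
  by case/allpairsP: h1 => -[Y v] [_ /= hv [_ ->]]; rewrite -words2.
by apply: allpairs_f; rewrite ?mem_enum ?words2.
Qed.

Lemma leaves_split s a A b : leaves s = a ++ A :: b ->
  exists s1 s2, [/\ s = s1 ++ Lf A :: s2, leaves s1 = a & leaves s2 = b].
Proof.
elim: s a => [|[B|k|k] s IH] a /=; first by case: a.
- case: a => [|C a] [<- e]; first by exists [::], s.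
  by have [s1 [s2 [-> <- <-]]] := IH _ e; exists (Lf B :: s1), s2.
- by move=> /IH [s1 [s2 [-> <- <-]]]; exists (Op k :: s1), s2.
- by move=> /IH [s1 [s2 [-> <- <-]]]; exists (Cl k :: s1), s2.
Qed.

Lemma denote_cat (Sigma : finType) I (ty : I -> itp) (lex : seq (Sigma * tp)) u v a b :
  denote ty lex u a -> denote ty lex v b -> denote ty lex (u ++ v) (a ++ b).
Proof. exact: List.Forall2_app. Qed.

Lemma denote_cat_l (Sigma : finType) I (ty : I -> itp) (lex : seq (Sigma * tp)) u v a :
  denote ty lex (u ++ v) a ->
  exists b c, [/\ denote ty lex u b, denote ty lex v c & a = b ++ c].
Proof. by case/List.Forall2_app_inv_l => b [c [hb [hc e]]]; exists b, c. Qed.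

Lemma denote_cat_r (Sigma : finType) I (ty : I -> itp) (lex : seq (Sigma * tp)) w a b :
  denote ty lex w (a ++ b) ->
  exists u v, [/\ denote ty lex u a, denote ty lex v b & w = u ++ v].
Proof. by case/List.Forall2_app_inv_r => u [v [hu [hv e]]]; exists u, v. Qed.

Lemma plain_cat s t : plain (s ++ t) = plain s && plain t.
Proof. exact: all_cat. Qed.

(** Every sentential form denotes the leaves of some antecedent that derives the
    start type; a production is applied to it by a cut. *)
Lemma derivation_sound (Sigma : finType) (G : cfg Sigma) (ty : nonterminal G -> itp) lex X w :
  (forall p, p \in productions G -> sound_production ty lex p) ->
  clos_refl_trans _ (@cfg_step Sigma G) [:: inl X] w ->
  exists s, [/\ cfree s (ty X), plain s & denote ty lex w (leaves s)].
Proof.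
move=> hG /clos_rt_rtn1_iff; elim=> [|_ _ [u v Y r hp] _ [s [d ps]]].
  exists [:: Lf (ty X)]; split=> //=.
    by have [h1 h2 _] := den_adequate (ty X); exact: h2.
  by constructor.
case/denote_cat_l=> a [[|A b] [ha hb e]]; first by inversion hb.
have {hb} [eA hb] : ty Y = A /\ denote ty lex v b by inversion hb.
have [s1 [s2 [es e1 e2]]] := leaves_split e.
have [t [dt pt ht]] := hG _ hp; rewrite /= eA in dt.
exists (s1 ++ t ++ s2); split.
- by apply: cut_admissible dt _; rewrite -es.
- by move: ps; rewrite es !plain_cat /= => /andP[-> ->]; rewrite pt.
- by rewrite !leaves_cat e1 e2; do 2?apply: denote_cat.
Qed.

Lemma derives_ctx (Sigma : finType) (G : cfg Sigma) u v x y :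
  clos_refl_trans _ (@cfg_step Sigma G) x y ->
  clos_refl_trans _ (@cfg_step Sigma G) (u ++ x ++ v) (u ++ y ++ v).
Proof.
elim=> [_ _ [u' v' X r hp]|z|x1 x2 x3 _ h1 _ h2]; [|exact: rt_refl|exact: rt_trans h1 h2].
have := @CfgStep _ G (u ++ u') (v' ++ v) X r hp.
by rewrite -!catA /= => h; apply: rt_step.
Qed.

Lemma leaves_ren f s : leaves (rens f s) = map (ren f) (leaves s).
Proof. by elim: s => [|[A|k|k] s IH] //=; rewrite IH. Qed.

(** A short piece is split off and replaced by its interpolant until at most two
    leaves remain, where a single production suffices.  The induction runs over
    thin sequents, which interpolation preserves, while the grammar sees only
    their images under the renaming [f]. *)
Lemma derivation_complete (Sigma : finType) (G : cfg Sigma) (ty : nonterminal G -> itp) lex m N f :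
  (forall p, size p.2 <= 2 -> sound_production ty lex p -> p \in productions G) ->
  (forall A, size (wty A) <= m -> all (named N) (wty A) -> exists X, ty X = A) ->
  forall s A X w, cfree s A -> thin s A -> small m s -> size (wty A) <= m ->
  plain (rens f s) -> all (named N) (wd (rens f s)) ->
  ty X = ren f A -> denote ty lex w (leaves (rens f s)) ->
  clos_refl_trans _ (@cfg_step Sigma G) [:: inl X] w.
Proof.
move=> hG hty s; have [n] := ubnP (size s).
elim: n s => // n IH s; rewrite ltnS => hn A X w d t hs hA ps ns eX hw.
have [le2|gt2] := leqP (size (leaves s)) 2.
  have := @CfgStep _ G [::] [::] X w; rewrite /= !cats0; move=> h; apply: rt_step.
  apply: h; apply: hG => /=.
    have -> : size w = size (leaves (rens f s)) := List.Forall2_length hw.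
    by rewrite leaves_ren size_map.
  by exists (rens f s); split=> //; rewrite eX; exact: cfree_ren.
have [l [D [r [es bD hD hc]]]] := short_piece d t hs hA gt2.
have nD : D <> [::] by move=> eD; rewrite eD in hD.
have [B hB] := interpolation d es bD nD.
rewrite es in d t hs ps ns hn hD hw.
have [tD tB sub sB] := interpolant_thin t hB; have [dD dB _ _] := hB.
have hBm := leq_trans sB hc.
move: ps ns hs hw; rewrite /small !map_cat !plain_cat !wd_cat !leaves_cat !all_cat.
move=> /and3P[pl pD pr] /and3P[nl nD' nr] /and3P[sl sD sr].
case/denote_cat_r=> u [w' [hu /denote_cat_r [v [z [hv hz ->]]] ->]].
have [XB eXB] : exists XB, ty XB = ren f B.
  apply: hty; rewrite wty_ren ?size_map // all_map; apply/allP => x /sub xD /=.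
  by move: nD'; rewrite wd_ren all_map => /allP /(_ _ xD).
have nB : all (named N) (wty (ren f B)).
  rewrite wty_ren all_map; apply/allP => x /sub xD /=.
  by move: nD'; rewrite wd_ren all_map => /allP /(_ _ xD).
case/andP: hD; rewrite !size_cat in hn * => D_gt1 D_lt.
apply: (rt_trans _ _ _ (u ++ inl XB :: z)).
  apply: (IH (l ++ Lf B :: r) _ A) => //.
  - by move: hn; rewrite size_cat /=; lia.
  - by rewrite /small leaves_cat all_cat sl /= hBm.
  - by rewrite map_cat plain_cat pl.
  - by rewrite map_cat wd_cat all_cat nl /= wd_cons all_cat nB.
  - rewrite map_cat leaves_cat; apply: denote_cat => //=.
    by constructor.
apply: (derives_ctx u z (x := [:: inl XB])).
by apply: (IH D _ B) => //; move: hn; lia.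
Qed.

Lemma bal_hedge s As : bal s -> plain s -> leaves s = map emb As ->
  exists H, flat H = s /\ yield H = As.
Proof.
have [n] := ubnP (size s); elim: n s As => // n IH [|[A|k|k] s] As hn //= bs ps.
- by case: As => // _; exists [::].
- case: As => [|a As] // [-> e].
  have [|H [<- <-]] := IH s As _ bs ps e; first by [].
  by exists (Leaf a :: H).
- have [D [r [es bD]]] := @bal_open_split [::] k s bs.
  have br : bal r by move: bs; rewrite es /bal /= run_bal_cat //= eqxx.
  move: ps hn; rewrite es plain_cat leaves_cat /= size_cat /= => /andP[/eqP -> /and3P[pD _ pr]] hn.
  move=> /esym /map_eq_cat [As1 [As2 [-> /esym e1 /esym e2]]].
  have [|K [<- <-]] := IH D As1 _ bD pD e1; first by lia.
  have [|H [<- <-]] := IH r As2 _ br pr e2; first by lia.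
  by exists (Bracket K :: H); rewrite flat_bracket.
Qed.

Lemma flat_plain H : plain (flat H).
Proof.
elim/hedge_ind: H => [|A H IH|K H IHK IH] //.
by rewrite flat_bracket /= plain_cat IHK.
Qed.

Lemma leaves_flat H : leaves (flat H) = map emb (yield H).
Proof.
elim/hedge_ind: H => [|A H IH|K H IHK IH] //; first by rewrite /= -IH.
by rewrite flat_bracket /= leaves_cat /= IHK IH -map_cat.
Qed.

Lemma denote_terminals (Sigma : finType) I (ty : I -> itp) (lex : seq (Sigma * tp)) w As :
  all2 (fun a A => (a, A) \in lex) w As -> denote ty lex (map inr w) (map emb As).
Proof.
elim: w As => [|a w IH] [|A As] //= /andP[aA /IH h].
by constructor=> //; exists A.
Qed.

Lemma terminals_denote (Sigma : finType) I (ty : I -> itp) (lex : seq (Sigma * tp)) w Bs :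
  denote ty lex (map inr w) Bs ->
  exists As, Bs = map emb As /\ all2 (fun a A => (a, A) \in lex) w As.
Proof.
elim: w Bs => [|a w IH] Bs /= h; inversion h; first by exists [::].
case: H1 => A aA ->; have [As [-> ha]] := IH _ H3.
by exists (A :: As); rewrite /= aA.
Qed.

Lemma named_plain N s : 0 < N -> plain s ->
  all (fun A => all (named N) (wty A)) (leaves s) -> all (named N) (wd s).
Proof.
move=> N0; elim: s => [|t s IH] //; rewrite wd_cons all_cat.
case: t => [A|k|k] /=.
- by move=> ps /andP[-> ns]; exact: IH.
- by case/andP=> /eqP -> ps ns; rewrite /named N0; exact: IH.
- by case/andP=> /eqP -> ps ns; rewrite /named N0; exact: IH.
Qed.

Theorem theorem14 (Sigma : finType) (L : language Sigma) :
  recognized L -> context_free L.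
Proof.
move=> [[lex D] hL].
(* Every lexical type and the goal is a block of [W], so its size bounds their
   lengths and its names bound their names; the successor leaves room for the
   index 0 of the brackets. *)
pose W := flatten [seq wty (emb p.2) | p <- lex] ++ wty (emb D).
pose m := size W.
pose N := (\max_(x <- W) x.2.2).+1.
have ok_sub A : {subset wty A <= W} -> all (named N) (wty A).
  move=> sub; apply/allP => x /sub xW; rewrite /named ltnS.
  exact: (leq_bigmax_seq (F := fun y : letter => y.2.2) x xW).
have D_ok : size (wty (emb D)) <= m /\ all (named N) (wty (emb D)).
  split; first by rewrite /m size_cat leq_addl.
  by apply: ok_sub => x xD; rewrite mem_cat xD orbT.
have lex_ok p : p \in lex -> size (wty (emb p.2)) <= m /\ all (named N) (wty (emb p.2)).
  move=> pl; have [W1 [W2 eW]] : exists W1 W2, W = W1 ++ wty (emb p.2) ++ W2.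
    case/mem_split2: pl => l1 [l2 el]; rewrite /W el map_cat flatten_cat /= -!catA.
    by exists (flatten [seq wty (emb p.2) | p <- l1]), (flatten [seq wty (emb p.2) | p <- l2] ++ wty (emb D)).
  split; first by rewrite /m eW !size_cat; lia.
  by apply: ok_sub => x xp; rewrite eW !mem_cat xp orbT.
have [T hT] := short_types m N.
pose ty (i : 'I_(size T)) := nth (emb D) T i.
have hty A : size (wty A) <= m -> all (named N) (wty A) -> exists X, ty X = A.
  move=> sA nA; have AT := hT A sA nA.
  have lt : index A T < size T by rewrite index_mem.
  by exists (Ordinal lt); rewrite /ty /= nth_index.
have [X0 eX0] := hty _ D_ok.1 D_ok.2.
have [prods hp] := exists_grammar ty lex.
exists (Cfg prods X0) => w; rewrite hL /cfg_language; split.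
- case=> H [/= dH wH].
  have lexH : forall A, A \in yield H -> exists a, (a, A) \in lex.
    elim: (yield H) w wH {dH} => [|B Bs IH] [|a w] //= /andP[aB /IH h] A.
    by rewrite inE => /predU1P[->|/h //]; exists a.
  have [f [s [A [d t es eA]]]] := thin_instance (provable_cfree dH).
  apply: (@derivation_complete _ (Cfg prods X0) ty lex m N f _ _ s A) => //=.
  + by move=> p p2 hs; apply/hp.
  + have : all (fun B => size (wty B) <= m) (leaves (rens f s)).
      rewrite es leaves_flat; apply/allP => _ /mapP [B /lexH [a /lex_ok /= [hB _]] ->].
      exact: hB.
    rewrite leaves_ren all_map => h; apply/allP => B /(allP h) /=.
    by rewrite wty_ren size_map.
  + by rewrite -(size_map (renl f)) -wty_ren eA; case: D_ok.
  + by rewrite es flat_plain.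
  + rewrite es; apply: named_plain (flat_plain H) _ => //.
    rewrite leaves_flat; apply/allP => _ /mapP [B /lexH [a /lex_ok /= [_ hB]] ->].
    exact: hB.
  + by rewrite eX0.
  + by rewrite es leaves_flat; exact: denote_terminals.
- move=> /(@derivation_sound _ (Cfg prods X0) ty lex) [|s [d ps]].
    by move=> p /hp [].
  case/terminals_denote=> As [eAs hAs].
  have [H [eH yH]] := bal_hedge (cfree_bal d) ps eAs.
  exists H; rewrite yH; split=> //=.
  by apply: (cfree_provable d eH); rewrite /= eX0.
Qed.
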